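(* Let $\Gamma=(G_0,\ldots,G_{n-1})$ be parametric games, $I\subseteq\mathrm{Par}$ a self-dual set of parameters, $G=\forall I.\Gamma$, and assume $\mathrm{FV}(G)=\emptyset$. Then: (1) $G$ is determined. (2) Assume that $\eta(G_0),\ldots,\eta(G_{n-1})$ are determined for every $I$-assignment $\eta$. Then the following are equivalent: (a) there is a $\mathsf P$-winning strategy for $G$; (b) $\mathrm{EXH}$ is a primitive recursive $\mathsf P$-winning strategy for $G$; (c) for every $I$-assignment $\eta$ there are $i<n$ and a $\mathsf P$-winning strategy $\sigma_i:\eta(G_i)$.
   Context: Players: $\mathsf P$ (Player), $\mathsf O$ (Opponent), $\mathsf P^\bot=\mathsf O$, $\mathsf O^\bot=\mathsf P$. Fix a countable set $M$ of moves and a countable set $\mathrm{Par}$ with an involution $a\mapsto a^\bot$ without fixed points; $J\subseteq\mathrm{Par}$ is self-dual if $J^\bot=J$. $\langle\rangle$ is the empty list, $x@y$ concatenation, $x@S=\{x@s:s\in S\}$. A tree support is a set $T$ of finite lists over $M$ containing $\langle\rangle$ and closed under prefixes; leaves are nodes without one-step extension in $T$; $T_\infty$ is the set of infinite sequences with all finite prefixes in $T$. A parametric game $G$: a tree support $|G|$ with an enumeration of the children of each node, $\mathrm{turn}_G$: non-leaves $\to\{\mathsf P,\mathsf O\}$, $\mathrm{win}_G$: leaves $\to\{\mathsf P,\mathsf O\}\cup\mathrm{Par}$, a partition $(G_{\mathsf P},G_{\mathsf O})$ of $|G|_\infty$. $\mathrm{FV}(G)$ is the smallest self-dual set containing $\mathrm{win}_G(\text{leaves})\cap\mathrm{Par}$.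 A $J$-assignment ($J$ self-dual) is $\rho:J\to\{\mathsf P,\mathsf O\}$ with $\rho(a^\bot)=\rho(a)^\bot$, extended by $\rho(g)=g$; $\rho(G)$ is $G$ with $\mathrm{win}_G$ replaced by $\rho\circ\mathrm{win}_G$. $G_x$ is the subgame at $x$. $\mathrm{END}(x)$ is the one-position game with root leaf labelled $x$; $G$ is atomic if $|G|=\{\langle\rangle\}$. A strategy $\sigma:G$ is a tree support $\sigma\subseteq|G|$; it is a $g$-strategy if for every non-leaf $p\in\sigma$ with $\mathrm{turn}_G(p)=g^\bot$ all one-step extensions of $p$ in $|G|$ lie in $\sigma$; $g$-total if moreover each non-leaf $p\in\sigma$ with $\mathrm{turn}_G(p)=g$ has a one-step extension in $\sigma$; $g$-partially winning if moreover $\mathrm{win}_G(p)=g$ for each leaf $p$ of $|G|$ in $\sigma$; $g$-winning if moreover all infinite branches of $\sigma$ lie in $G_g$. $G$ is determined if it has a $g$-winning strategy for some player $g$. The game $\forall I.\Gamma$: $M$ contains primitive recursive injective constructors $\mathrm{DROP}(n),\mathrm{EM}(n,m),\mathrm{STOP}(n),\mathrm{JUST}(n,m),\mathrm{nth}(n)$ with disjoint ranges covering $M$. $\mathrm{FV}(\Gamma)=\bigcup_i\mathrm{FV}(G_i)$. The root has local positions $G_0,\ldots,G_{n-1}$. If $p=\langle\mathrm{JUST}(i_0,n),m_0,\ldots,\mathrm{JUST}(i_{k-1},n+k-1),m_{k-1}\rangle$ has local positions $G_0,\ldots,G_{n+k-1}$, then $\mathrm{turn}(p)=\mathsf P$ and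 $p@m$ is a position iff: $m=\mathrm{DROP}(n+k)$; or $m=\mathrm{EM}(i,j)$ with $i,j<n+k$, $G_i=\mathrm{END}(a)$, $G_j=\mathrm{END}(a^\bot)$, $a\in I$; or $m=\mathrm{STOP}(i)$ with $i<n+k$, $G_i=\mathrm{END}(x)$, $x\in\{\mathsf P,\mathsf O\}\cup(\mathrm{FV}(\Gamma)\setminus I)$; or $m=\mathrm{JUST}(i_k,n+k)$ with $i_k<n+k$, $G_{i_k}$ not atomic. The first three are leaves with winner $\mathsf O$, $\mathsf P$, $\mathrm{win}_{G_i}(\langle\rangle)$. If $p_1=p@\mathrm{JUST}(i_k,n+k)$, $\mathrm{turn}(p_1)=\mathrm{turn}_{G_{i_k}}(\langle\rangle)$, and $p_1@m_k$ is a position iff $\langle m_k\rangle\in|G_{i_k}|$; its local positions are $G_0,\ldots,G_{n+k}$ with $G_{n+k}=(G_{i_k})_{\langle m_k\rangle}$, and $i_k\vdash_{m_k}n+k$. For infinite plays use the union over finite prefixes. For finite $q=\langle m_0,\ldots,m_{r-1}\rangle$, $q\prec_i p$ if there are indices $i=j_0<\cdots<j_r$ with $j_s\vdash_{m_s}j_{s+1}$ in $p$; for infinite $q$, if there is an infinite such chain. $G_{\mathsf P}$: infinite $p$ with some infinite $q\prec_i p$ ($i<n$) in $(G_i)_{\mathsf P}$; $G_{\mathsf O}$: the other infinite plays. $\mathrm{FV}(\forall I.\Gamma)=\mathrm{FV}(\Gamma)\setminus I$. The strategy $\mathrm{EXH}=\mathrm{exh}(0,n,n,\emptyset)$, where $\mathrm{exh}(i,c,q,J)$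 ($i\le c\le q$, $J$ a list of triples; $G_0,\ldots,G_{q-1}$ the current local positions) is given by the first applicable clause: (REPEAT) $i=c<q$: $\mathrm{exh}(0,q,q,J)$. (DROP) $i=c=q$: $\{\langle\rangle,\langle\mathrm{DROP}(q)\rangle\}$. (EM) $i<c$, $G_i=\mathrm{END}(a)$, $a\in I$, with a least $j<c$ such that $G_j=\mathrm{END}(a^\bot)$: $\{\langle\rangle,\langle\mathrm{EM}(i,j)\rangle\}$. (STOP) $i<c$, $G_i=\mathrm{END}(\mathsf P)$: $\{\langle\rangle,\langle\mathrm{STOP}(i)\rangle\}$. (SKIP) $i<c$, $G_i$ atomic: $\mathrm{exh}(i+1,c,q,J)$. (TRYALL) $i<c$, $G_i$ not atomic, $K$ the set of moves from the root of $G_i$: (a) if $\mathrm{turn}_{G_i}(\langle\rangle)=\mathsf P$ and some $m\in K$ has no triple $(i,m,k)$ in $J$, take the first such $m$ and set $\mathrm{exh}=\{\langle\rangle,\langle\mathrm{JUST}(i,q)\rangle\}\cup\mathrm{JUST}(i,q)@m@\mathrm{exh}(i+1,c,q+1,J@(i,m,q))$, else $\mathrm{exh}(i+1,c,q,J)$; (b) if $\mathrm{turn}_{G_i}(\langle\rangle)=\mathsf O$ and $J$ has no triple $(i,m,k)$, set $\mathrm{exh}=\{\langle\rangle,\langle\mathrm{JUST}(i,q)\rangle\}\cup\bigcup_{m\in K}\mathrm{JUST}(i,q)@m@\mathrm{exh}(i+1,c,q+1,J@(i,m,q))$, else $\mathrm{exh}(i+1,c,q,J)$. (After the moves $\mathrm{JUST}(i,q),m$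 the local position $G_q=(G_i)_{\langle m\rangle}$ is added.) ''Primitive recursive'' means primitive recursive relative to the finitary parts (all data except the partitions) of $G_0,\ldots,G_{n-1}$.
   Formalization: In (b), ''primitive recursive'' is taken relative to the finitary parts of the games together with the involution on codes of parameters; without this the claim fails when the involution is not computable. *)

(* Defs.v *)
From HB Require Import structures.
From mathcomp Require Import all_boot.
From mathcomp Require Import all_classical.

Set Implicit Arguments.
Unset Strict Implicit.
Unset Printing Implicit Defensive.

Local Open Scope classical_set_scope.

Inductive player := PlayerP | PlayerO.

Definition opp (g : player) : player :=
  match g with PlayerP => PlayerO | PlayerO => PlayerP end.

Definition bool_of_player (g : player) : bool :=
  match g with PlayerP => true | PlayerO => false end.
Definition player_of_bool (b : bool) : player :=
  if b then PlayerP else PlayerO.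
Lemma bool_of_playerK : cancel bool_of_player player_of_bool.
Proof. by case. Qed.
HB.instance Definition _ := Countable.copy player (can_type bool_of_playerK).

(* The set of moves: injective constructors with disjoint ranges covering it
   make it this inductive type. Moves are coded by short lists of numbers, for
   which the constructors and their inverses are primitive recursive. *)
Inductive gmove :=
  | Drop of nat
  | Em of nat & nat
  | Stop of nat
  | Just of nat & nat
  | Nth of nat.

Definition gmove_code (m : gmove) : seq nat :=
  match m with
  | Drop n => [:: 0; n]
  | Em n k => [:: 1; n; k]
  | Stop n => [:: 2; n]
  | Just n k => [:: 3; n; k]
  | Nth n => [:: 4; n]
  end.
Definition gmove_decode (s : seq nat) : option gmove :=
  match s with
  | [:: 0; n] => Some (Drop n)
  | [:: 1; n; k] => Some (Em n k)
  | [:: 2; n] => Some (Stop n)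
  | [:: 3; n; k] => Some (Just n k)
  | [:: 4; n] => Some (Nth n)
  | _ => None
  end.
Lemma gmove_codeK : pcancel gmove_code gmove_decode.
Proof. by case. Qed.
HB.instance Definition _ := Countable.copy gmove (pcan_type gmove_codeK).

Record params := Params {
  par :> countType;
  dual : par -> par;
  dualK : involutive dual;
  dual_neq : forall a, dual a != a }.

Section Games.
Variable A : params.
Implicit Types (I F : set A).

Definition selfdual (J : set A) : Prop := @dual A @` J = J.

Definition label : Type := (player + A)%type.

(* The data of a parametric game, without the axioms of [is_game]. [turn] and
   [win] are total, but only their values on non-leaves, respectively on
   leaves, are meaningful. [children p 0], [children p 1], ... lists the moves
   leading to the children of [p]. [inf g] is the part G_g of the partition of
   the infinite plays. *)
Record game := Game {
  pos : set (seq gmove);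
  children : seq gmove -> nat -> option gmove;
  turn : seq gmove -> player;
  win : seq gmove -> label;
  inf : player -> set (nat -> gmove) }.

Definition tree_support (T : set (seq gmove)) : Prop :=
  T [::] /\ forall s t, T (s ++ t) -> T s.

Definition branches (T : set (seq gmove)) : set (nat -> gmove) :=
  [set f | forall k, T (mkseq f k)].

(* Children are enumerated without repetition along an initial segment of
   nat. *)
Definition is_enumeration (T : set (seq gmove))
    (e : seq gmove -> nat -> option gmove) : Prop :=
  forall p,
  [/\ forall m, T (rcons p m) <-> exists k, e p k = Some m,
      forall k l m, e p k = Some m -> e p l = Some m -> k = l
    & forall k l, k <= l -> e p k = None -> e p l = None].

Definition is_game (G : game) : Prop :=
  [/\ tree_support (pos G),
      is_enumeration (pos G) (children G),
      inf G PlayerP `&` inf G PlayerO = set0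
    & inf G PlayerP `|` inf G PlayerO = branches (pos G)].

Definition leaf (G : game) (p : seq gmove) : Prop :=
  pos G p /\ ~ exists m, pos G (rcons p m).
Definition nonleaf (G : game) (p : seq gmove) : Prop :=
  pos G p /\ exists m, pos G (rcons p m).

Definition FV (G : game) : set A :=
  smallest selfdual [set a | exists2 p, leaf G p & win G p = inr a].

Definition prepend (x : seq gmove) (f : nat -> gmove) : nat -> gmove :=
  fun k => nth (f (k - size x)) x k.

Definition subgame (G : game) (x : seq gmove) : game := Game
  [set s | pos G (x ++ s)]
  (fun s => children G (x ++ s))
  (fun s => turn G (x ++ s))
  (fun s => win G (x ++ s))
  (fun g => [set f | inf G g (prepend x f)]).

Definition atomic (G : game) : Prop := pos G = [set [::]].

Definition END (x : label) : game := Game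
  [set [::]] (fun _ _ => None) (fun=> PlayerP) (fun=> x) (fun=> set0).

(* G = END(x), up to the meaningless values of [turn] and [win]. *)
Definition is_END (G : game) (x : label) : Prop :=
  atomic G /\ win G [::] = x.

(* A J-assignment is given by a total function, whose values outside J are
   irrelevant. *)
Definition assignment (J : set A) (rho : A -> player) : Prop :=
  forall a, J a -> rho (dual a) = opp (rho a).

Definition assign (J : set A) (rho : A -> player) (G : game) : game := Game
  (pos G) (children G) (turn G)
  (fun p => match win G p with
            | inl g => inl g
            | inr a => if `[< J a >] then inl (rho a) else inr a
            end)
  (inf G).

Section Strategies.
Variables (G : game) (g : player) (S : set (seq gmove)).

Definition strategy : Prop := tree_support S /\ S `<=` pos G.

Definition g_strategy : Prop :=
  strategy /\
  forall p, S p -> nonleaf G p -> turn G p = opp g ->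
    forall m, pos G (rcons p m) -> S (rcons p m).

Definition g_total : Prop :=
  g_strategy /\
  forall p, S p -> nonleaf G p -> turn G p = g -> exists m, S (rcons p m).

Definition g_partially_winning : Prop :=
  g_total /\ forall p, S p -> leaf G p -> win G p = inl g.

Definition g_winning : Prop :=
  g_partially_winning /\ branches S `<=` inf G g.

End Strategies.

Definition determined (G : game) : Prop := exists g S, g_winning G g S.

(* The game forall I. Gamma. Below, L is a list of local positions, and a
   position is read two moves at a time, from the list of local positions
   reached so far. *)

Definition loc (L : seq game) (i : nat) : game := nth (END (inl PlayerP)) L i.

Definition FVs (L : seq game) : set A :=
  \bigcup_(i in [set i | i < size L]) FV (loc L i).

Definition extend (L : seq game) (i : nat) (m : gmove) : seq game :=
  rcons L (subgame (loc L i) [:: m]).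

(* The moves available to P; F stands for FV(Gamma) \ I. *)
Definition P_move I F (L : seq game) (m : gmove) : Prop :=
  match m with
  | Drop k => k = size L
  | Em i j => [/\ i < size L, j < size L &
      exists a, [/\ I a, is_END (loc L i) (inr a)
                  & is_END (loc L j) (inr (dual a))]]
  | Stop i => i < size L /\
      ((exists g, is_END (loc L i) (inl g)) \/
       (exists2 a, F a & is_END (loc L i) (inr a)))
  | Just i k => [/\ i < size L, k = size L & ~ atomic (loc L i)]
  | Nth _ => False
  end.

Fixpoint quant_pos I F (L : seq game) (p : seq gmove) : Prop :=
  match p with
  | [::] => True
  | [:: m] => P_move I F L m
  | m :: m' :: p' =>
      P_move I F L m /\
      if m is Just i _ then
        pos (loc L i) [:: m'] /\ quant_pos I F (extend L i m') p'
      else False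
  end.

Definition P_moves I F (L : seq game) : seq gmove :=
  let q := iota 0 (size L) in
  [seq m <- Drop (size L)
            :: [seq Em i j | i <- q, j <- q]
            ++ [seq Stop i | i <- q]
            ++ [seq Just i (size L) | i <- q] | `[< P_move I F L m >]].

Fixpoint quant_children I F (L : seq game) (p : seq gmove)
    : nat -> option gmove :=
  match p with
  | [::] => onth (P_moves I F L)
  | [:: Just i _] => children (loc L i) [::]
  | Just i _ :: m :: p' => quant_children I F (extend L i m) p'
  | _ => fun=> None
  end.

Fixpoint quant_turn (L : seq game) (p : seq gmove) : player :=
  match p with
  | [:: Just i _] => turn (loc L i) [::]
  | Just i _ :: m :: p' => quant_turn (extend L i m) p'
  | _ => PlayerP
  end.

Fixpoint quant_win (L : seq game) (p : seq gmove) : label :=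
  match p with
  | [:: Em _ _] => inl PlayerP
  | [:: Stop i] => win (loc L i) [::]
  | Just i _ :: m :: p' => quant_win (extend L i m) p'
  | _ => inl PlayerO
  end.

(* i |-_m j in the infinite play p, with n initial local positions *)
Definition justifies (n : nat) (p : nat -> gmove) (i : nat) (m : gmove)
    (j : nat) : Prop :=
  exists k, [/\ j = n + k, p k.*2 = Just i j & p k.*2.+1 = m].

Definition infinite_chain (n : nat) (p q : nat -> gmove) (i : nat) : Prop :=
  exists j : nat -> nat,
    [/\ j 0 = i, forall s, j s < j s.+1
      & forall s, justifies n p (j s) (q s) (j s.+1)].

Definition P_thread (L : seq game) (p : nat -> gmove) : Prop :=
  exists i q, [/\ i < size L, infinite_chain (size L) p q i
                & inf (loc L i) PlayerP q].

Definition quant I (Gamma : seq game) : game :=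
  let F := FVs Gamma `\` I in
  let T := quant_pos I F Gamma in
  Game T
    (fun p => if `[< T p >] then quant_children I F Gamma p else fun=> None)
    (quant_turn Gamma)
    (quant_win Gamma)
    (fun g => match g with
              | PlayerP => branches T `&` P_thread Gamma
              | PlayerO => branches T `\` P_thread Gamma
              end).

(* The strategy EXH. Since every infinite sequence of clauses produces
   infinitely many moves, the sets exh(i, c, q, J) are given by an inductive
   predicate; q is the length of the list L of current local positions. *)

Definition triple : Type := (nat * gmove * nat)%type.

Definition em_clause I (L : seq game) (i c j : nat) : Prop :=
  exists a, [/\ I a, is_END (loc L i) (inr a), j < c,
                is_END (loc L j) (inr (dual a))
              & forall j', j' < j -> ~ is_END (loc L j') (inr (dual a))].

Definition tried (J : seq triple) (i : nat) (m : gmove) : bool :=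
  has (fun t : triple => (t.1.1 == i) && (t.1.2 == m)) J.

Definition first_untried (G : game) (J : seq triple) (i : nat) (m : gmove)
    : Prop :=
  exists k, [/\ children G [::] k = Some m, ~~ tried J i m
              & forall k' m', k' < k -> children G [::] k' = Some m' ->
                  tried J i m'].

(* m is one of the moves with which TRYALL extends the play through G_i *)
Definition try_move (L : seq game) (J : seq triple) (i : nat) (m : gmove)
    : Prop :=
  match turn (loc L i) [::] with
  | PlayerP => first_untried (loc L i) J i m
  | PlayerO => pos (loc L i) [:: m] /\ ~~ has (fun t : triple => t.1.1 == i) J
  end.

Inductive exh I : seq game -> nat -> nat -> seq triple -> set (seq gmove) :=
  | exh_repeat L c J s :
      c < size L -> exh I L 0 (size L) J s -> exh I L c c J s
  | exh_drop L J s :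
      s = [::] \/ s = [:: Drop (size L)] ->
      exh I L (size L) (size L) J s
  | exh_em L i c J j s :
      i < c -> em_clause I L i c j ->
      s = [::] \/ s = [:: Em i j] ->
      exh I L i c J s
  | exh_stop L i c J s :
      i < c -> is_END (loc L i) (inl PlayerP) ->
      s = [::] \/ s = [:: Stop i] ->
      exh I L i c J s
  | exh_skip L i c J s :
      i < c -> ~ (exists j, em_clause I L i c j) ->
      ~ is_END (loc L i) (inl PlayerP) -> atomic (loc L i) ->
      exh I L i.+1 c J s -> exh I L i c J s
  | exh_try_just L i c J m s :
      i < c -> ~ atomic (loc L i) -> try_move L J i m ->
      s = [::] \/ s = [:: Just i (size L)] ->
      exh I L i c J s
  | exh_try_move L i c J m s :
      i < c -> ~ atomic (loc L i) -> try_move L J i m ->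
      exh I (extend L i m) i.+1 c (rcons J (i, m, size L)) s ->
      exh I L i c J (Just i (size L) :: m :: s)
  | exh_try_none L i c J s :
      i < c -> ~ atomic (loc L i) -> ~ (exists m, try_move L J i m) ->
      exh I L i.+1 c J s -> exh I L i c J s.

Definition EXH I (Gamma : seq game) : set (seq gmove) :=
  exh I Gamma 0 (size Gamma) [::].

End Games.

(* The game axioms are preserved by subgames and by forall I. Gamma. *)
Section Wellformedness.
Variable A : params.
Implicit Types (I F : set A) (L : seq (game A)).

Lemma subgame_is_game (G : game A) x : is_game G -> pos G x -> is_game (subgame G x).
Proof.
move=> [[G0 Gpre] Ge GI GU] px.
have E f k : mkseq (prepend x f) (size x + k) = x ++ mkseq f k.
  rewrite /mkseq iotaD map_cat; congr cat.
    rewrite -[RHS](mkseq_nth (Drop 0)) /mkseq; apply/eq_in_map => j; rewrite mem_iota add0n => /= jx.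
    by rewrite /prepend; apply: set_nth_default.
  rewrite add0n -[X in iota X _]addn0 iotaDl -map_comp; apply: eq_map => j /=.
  by rewrite /prepend nth_default ?leq_addr // addKn.
have B f : branches (pos G) (prepend x f) <-> branches (pos (subgame G x)) f.
  split=> H k /=; first by rewrite -E; apply: H.
  have := H k => /=; rewrite -E addnC; rewrite /mkseq iotaD map_cat; exact: Gpre.
split.
- split=> /=; first by rewrite cats0.
  by move=> s t; rewrite catA; apply: Gpre.
- move=> p; have [E1 E2 E3] := Ge (x ++ p); split=> //= m.
  by rewrite -rcons_cat; apply: E1.
- apply/seteqP; split=> f //= [fP fO].
  by rewrite -[False]/(set0 (prepend x f)) -GI.
- apply/seteqP; split=> f /=.
    by move=> H; apply/B; rewrite -GU.
  by move=> /B; rewrite -GU.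
Qed.

Definition games L := forall i, i < size L -> is_game (loc L i).

Lemma games_extend L i m : games L -> i < size L -> pos (loc L i) [:: m] ->
  games (extend L i m).
Proof.
move=> HL iL pm j; rewrite /extend size_rcons ltnS /loc nth_rcons.
case: (ltngtP j (size L)) => // [jL|_] _; first exact: HL.
by apply: subgame_is_game => //; apply: HL.
Qed.

Lemma P_moveP I F L m : P_move I F L m <-> m \in P_moves I F L.
Proof.
split; last by rewrite mem_filter => /andP[/asboolP].
move=> H; rewrite mem_filter; apply/andP; split; first exact/asboolP.
case: m H => [k|i j|i|i k|k] //=.
- by move=> ->; rewrite inE eqxx.
- case=> iL jL _; rewrite inE mem_cat; apply/orP; right; apply/orP; left.
  by apply/allpairsP; exists (i, j); rewrite !mem_iota.
- case=> iL _; rewrite inE !mem_cat; apply/orP; right; apply/orP; right; apply/orP; left.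
  by apply/mapP; exists i; rewrite ?mem_iota.
- case=> iL -> _; rewrite inE !mem_cat; apply/orP; right; apply/orP; right; apply/orP; right.
  by apply/mapP; exists i; rewrite ?mem_iota.
Qed.

Lemma P_moves_uniq I F L : uniq (P_moves I F L).
Proof.
rewrite filter_uniq //= !cat_uniq !mem_cat !negb_or.
have N0 : Drop (size L) \notin [seq Em i j | i <- iota 0 (size L), j <- iota 0 (size L)].
  by apply/allpairsP => -[[? ?] [_ _]].
have N1 : Drop (size L) \notin [seq Stop i | i <- iota 0 (size L)] by apply/mapP => -[].
have N2 : Drop (size L) \notin [seq Just i (size L) | i <- iota 0 (size L)] by apply/mapP => -[].
rewrite N0 N1 N2 /=; apply/and3P; split.
- by apply: allpairs_uniq; rewrite ?iota_uniq // => -[? ?] [? ?] _ _ /= [-> ->].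
- apply/hasPn => m; rewrite mem_cat => /orP[] /mapP[i _ ->] /=; apply/allpairsP => -[[? ?] [_ _]] //.
- rewrite map_inj_uniq ?iota_uniq //=; last by move=> ? ? [].
  apply/andP; split; first by apply/hasPn => m /mapP[i _ ->]; apply/mapP => -[].
  by rewrite map_inj_uniq ?iota_uniq // => ? ? [].
Qed.

Lemma quant_tree I F L : games L -> tree_support (quant_pos I F L).
Proof.
move=> HL; split=> // s t.
have [k] := ubnP (size s); elim: k s t L HL => // k IH [|m [|m' s]] t L HL //=.
  by case: t => [|? ?] //= _ [].
rewrite ltnS => sk [Pm K]; split=> //; case: m Pm K => // i q [iL _ _] [H1 H2].
split=> //; apply: IH H2; first exact: games_extend.
exact: ltnW.
Qed.

Lemma onth_enum (T : eqType) (s : seq T) : uniq s ->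
 [/\ forall m, m \in s <-> exists k, onth s k = Some m,
      forall k l m, onth s k = Some m -> onth s l = Some m -> k = l
    & forall k l, k <= l -> onth s k = None -> onth s l = None].
Proof.
move=> us; split.
- move=> m; split.
    move=> ms; exists (index m s); rewrite onthE (nth_map m) ?index_mem // nth_index //.
  case=> k E; have kl : k < size s by rewrite -onthTE E.
  by rewrite -(@onth_nth _ m m _ _ E) mem_nth.
- move=> k l m Ek El.
  have kl : k < size s by rewrite -onthTE Ek.
  have ll : l < size s by rewrite -onthTE El.
  apply/eqP; rewrite -(nth_uniq m kl ll us).
  by rewrite (@onth_nth _ m m _ _ Ek) (@onth_nth _ m m _ _ El).
- move=> k l kl E; apply: onth_default; apply: leq_trans kl.
  by rewrite -onthNE E.
Qed.

Lemma quant_enum I F L p : games L -> quant_pos I F L p ->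
  let e := quant_children I F L p in 
  [/\ forall m, quant_pos I F L (rcons p m) <-> exists k, e k = Some m,
      forall k l m, e k = Some m -> e l = Some m -> k = l
    & forall k l, k <= l -> e k = None -> e l = None].
Proof.
have [k] := ubnP (size p); elim: k p L => // k IH [|m [|m' s]] L /= sk HL.
- have [E1 E2 E3] := onth_enum (P_moves_uniq I F L).
  by move=> _; split=> // m; rewrite -E1 -P_moveP.
- case: m sk => [q|i j|i|i q|q] sk H /=; last first.
  + by [].
  + have [iL _ _] := H; have [_ E _ _] := HL _ iL; have [E1 E2 E3] := E [::]; split=> //= m.
    by rewrite -E1 /=; split=> [[_ []]|].
  + by split=> // m0; split; case.
  + by split=> // m0; split; case.
  + by split=> // m0; split; case.
- case=> [Pm K]; case: m sk Pm K => [q|i j|i|i q|q] //= sk Pm [H1 H2]; have [iL _ _] := Pm.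
  have [|||E1 E2 E3] := IH s (extend L i m') => //.
  + exact: ltnW.
  + exact: games_extend.
  split=> [m0|k0 l0 m0|k0 l0]; last exact: E3; last exact: E2.
  rewrite -E1; split=> [[_ []]//|H]; split=> //.
Qed.

Lemma quant_is_game I L : games L -> is_game (quant I L).
Proof.
move=> HL; split; first exact: quant_tree.
- move=> p /=; case: asboolP => [H|H]; first exact: quant_enum.
  split=> // m; split=> [|[]//]; rewrite -cats1 => K; case: H.
  exact: (proj2 (quant_tree _ _ HL)) K.
- by apply/seteqP; split=> f //= [[_ ?] [_ ]].
- apply/seteqP; split=> f /=; first by case=> [[]|[]].
  by move=> H; case: (pselect (P_thread L f)) => K; [left|right].
Qed.

End Wellformedness.

(* Functions primitive recursive relative to a set of unary oracles. *)
Inductive prim_rec (orc : set (nat -> nat)) :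
    forall n, (n.-tuple nat -> nat) -> Prop :=
  | pr_oracle f : orc f -> prim_rec orc (fun v : 1.-tuple nat => f (thead v))
  | pr_zero n : prim_rec orc (fun _ : n.-tuple nat => 0)
  | pr_succ : prim_rec orc (fun v : 1.-tuple nat => (thead v).+1)
  | pr_proj n (i : 'I_n) : prim_rec orc (fun v : n.-tuple nat => tnth v i)
  | pr_comp n k (g : k.-tuple nat -> nat) (h : 'I_k -> n.-tuple nat -> nat) :
      prim_rec orc g -> (forall i, prim_rec orc (h i)) ->
      prim_rec orc (fun v : n.-tuple nat => g [tuple h i v | i < k])
  | pr_rec n (g : n.-tuple nat -> nat) (h : n.+2.-tuple nat -> nat)
      (f : n.+1.-tuple nat -> nat) :
      prim_rec orc g -> prim_rec orc h ->
      (forall v : n.-tuple nat, f [tuple of 0 :: v] = g v) ->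
      (forall x (v : n.-tuple nat),
         f [tuple of x.+1 :: v] =
         h [tuple of x :: [tuple of f [tuple of x :: v] :: v]]) ->
      prim_rec orc f.

(* The function on numbers induced by f through the codes of the elements of
   T and U, with value 0 outside the set of codes. *)
Definition coded (T U : countType) (f : T -> U) : nat -> nat :=
  fun x => if pickle_inv x is Some t then pickle (f t) else 0.

Section Effectivity.
Variable A : params.

Definition finitary_part (G : game A) : set (nat -> nat) :=
  [set coded (fun p => `[< pos G p >]);
       coded (fun pk => children G pk.1 pk.2);
       coded (fun p => if `[< nonleaf G p >] then Some (turn G p) else None);
       coded (fun p => if `[< leaf G p >]
                       then Some (win G p : (player + A)%type) else None)].

(* The involution of the parameters is fixed along with their codes, and is
   not assumed to be primitive recursive in them: it is one of the oracles. *)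
Definition oracles (Gamma : seq (game A)) : set (nat -> nat) :=
  [set coded (@dual A)] `|`
  \bigcup_(i in [set i | i < size Gamma]) finitary_part (loc Gamma i).

Definition prim_rec_strategy (Gamma : seq (game A)) (S : set (seq gmove))
    : Prop :=
  prim_rec (oracles Gamma)
    (fun v : 1.-tuple nat => coded (fun p => `[< S p >]) (thead v)).

End Effectivity.

(* Main.v *)
Require Import Defs.
From mathcomp Require Import all_boot.
From mathcomp Require Import all_classical.
From mathcomp Require Import zify.

(* In a play that EXH loses, every local position whose root belongs to P has
   been continued with all moves, and every one whose root belongs to O with some
   move. Hence the positions reached from G_i form an O-strategy for G_i. As no EM
   and no STOP move was found, some I-assignment eta gives all the labels met to
   O, and because P has no winning thread, these strategies are O-winning for all
   the games eta(G_i). Conversely, O-winning strategies for all eta(G_i) are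
   combined into one for forall I. Gamma, by following them in each local
   position. So either EXH is P-winning, or O wins all eta(G_i) for some eta, and
   O wins forall I. Gamma. The rest holds as no game is won by both players.
   EXH is primitive recursive because at each moment it makes a bounded number
   of steps without a move, so that membership of a finite play is decided by
   iterating a step function a bounded number of times. *)

Set Implicit Arguments.
Unset Strict Implicit.
Unset Printing Implicit Defensive.

Local Open Scope classical_set_scope.

(** * Relative primitive recursion over countable types *)

(** That [forall I. Gamma] has no free parameters means that all labels of [Gamma] lie in [I]: a
    leaf with another label could be reached in a play and stopped there. Hence an I-assignment
    decides every label, and the search for EM needs no test for membership in [I], which is not
    among the oracles. A lost play is either finite and ends with DROP, or infinite without a thread
    won by P. In the first case all local positions have been passed in the last pass. In the
    second, fairness does the same in the limit: a fixed position is visited again and again, with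
    ever more positions below the bound [c], and each visit takes the next untried move. Both cases
    satisfy the same hypotheses on a set of indices with a justification relation, so the assignment
    and the O-strategies are built once for both. The search for an untried move at a position with
    infinitely many moves looks unbounded, but [J] is a finite list, so among any [size J + 1]
    distinct moves one is untried. *)

Section PrimRec.
Variable orc : set (nat -> nat).

Definition pr1 (f : nat -> nat) := prim_rec orc (fun v : 1.-tuple nat => f (thead v)).
Definition pr2 (f : nat -> nat -> nat) :=
  prim_rec orc (fun v : 2.-tuple nat => f (tnth v ord0) (tnth v ord_max)).
Definition pr3 (f : nat -> nat -> nat -> nat) :=
  prim_rec orc (fun v : 3.-tuple nat =>
    f (tnth v ord0) (tnth v (inord 1)) (tnth v ord_max)).

Lemma eq_prim_rec n (f g : n.-tuple nat -> nat) :
  f =1 g -> prim_rec orc f -> prim_rec orc g.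
Proof. by move=> /funext ->. Qed.

Lemma prim_rec_comp1 n f (a : n.-tuple nat -> nat) :
  pr1 f -> prim_rec orc a -> prim_rec orc (fun v => f (a v)).
Proof.
move=> pf pa; apply: eq_prim_rec (pr_comp pf (fun _ => pa)) => v.
by rewrite /thead tnth_mktuple.
Qed.

Lemma prim_rec_comp2 n f (a b : n.-tuple nat -> nat) :
  pr2 f -> prim_rec orc a -> prim_rec orc b -> prim_rec orc (fun v => f (a v) (b v)).
Proof.
move=> pf pa pb; pose h (i : 'I_2) := if val i is 0 then a else b.
have ph i : prim_rec orc (h i) by rewrite /h; case: (val i).
by apply: eq_prim_rec (pr_comp pf ph) => v; rewrite !tnth_mktuple.
Qed.

(** * Composition and arithmetic of numbers *)

Lemma pr1_id : pr1 id. Proof. exact: pr_proj. Qed.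
Lemma pr1_comp f g : pr1 f -> pr1 g -> pr1 (fun x => f (g x)).
Proof. exact: prim_rec_comp1. Qed.
Lemma pr1_const k : pr1 (fun=> k).
Proof.
elim: k => [|k IH]; first exact: pr_zero.
exact: prim_rec_comp1 (pr_succ _) IH.
Qed.
Lemma pr1_comp2 f g h : pr2 f -> pr1 g -> pr1 h -> pr1 (fun x => f (g x) (h x)).
Proof. exact: prim_rec_comp2. Qed.

Lemma pr2_fst : pr2 (fun x _ => x). Proof. exact: pr_proj. Qed.
Lemma pr2_snd : pr2 (fun _ x => x). Proof. exact: pr_proj. Qed.
Lemma pr2_comp1 f g : pr1 f -> pr2 g -> pr2 (fun x y => f (g x y)).
Proof. exact: prim_rec_comp1. Qed.
Lemma pr2_comp2 f g h : pr2 f -> pr2 g -> pr2 h -> pr2 (fun x y => f (g x y) (h x y)).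
Proof. exact: prim_rec_comp2. Qed.
Lemma pr3_1 : pr3 (fun x _ _ => x). Proof. exact: pr_proj. Qed.
Lemma pr3_2 : pr3 (fun _ x _ => x). Proof. exact: pr_proj. Qed.
Lemma pr3_3 : pr3 (fun _ _ x => x). Proof. exact: pr_proj. Qed.
Lemma pr3_comp1 f g : pr1 f -> pr3 g -> pr3 (fun x y z => f (g x y z)).
Proof. exact: prim_rec_comp1. Qed.
Lemma pr3_comp2 f g h :
  pr2 f -> pr3 g -> pr3 h -> pr3 (fun x y z => f (g x y z) (h x y z)).
Proof. exact: prim_rec_comp2. Qed.

Lemma pr2_rec f g h : pr1 g -> pr3 h ->
  (forall y, f 0 y = g y) -> (forall x y, f x.+1 y = h x (f x y) y) -> pr2 f.
Proof.
move=> pg ph f0 fS.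
apply: (pr_rec pg ph) => [v|x v] /=.
  by rewrite f0 /thead; congr g; rewrite !(tnth_nth 0).
by rewrite fS !(tnth_nth 0) /= inordK.
Qed.

Lemma pr1_rec f k h : pr2 h -> f 0 = k -> (forall x, f x.+1 = h x (f x)) -> pr1 f.
Proof.
move=> ph f0 fS.
have H : pr2 (fun x _ => f x).
  apply: (@pr2_rec _ (fun=> k) (fun x r _ => h x r)) => //; first exact: pr1_const.
  by apply: prim_rec_comp2 => //; [exact: pr3_1 | exact: pr3_2].
exact: (pr1_comp2 H pr1_id pr1_id).
Qed.

Lemma pr2_add : pr2 addn.
Proof.
apply: (@pr2_rec _ id (fun _ r _ => r.+1)) => //; first exact: pr1_id.
by apply: pr3_comp1; [exact: pr_succ | exact: pr3_2].
Qed.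

Lemma pr2_mul : pr2 muln.
Proof.
apply: (@pr2_rec _ (fun=> 0) (fun _ r y => y + r)) => //; first exact: pr1_const.
by apply: pr3_comp2; [exact: pr2_add | exact: pr3_3 | exact: pr3_2].
Qed.

Lemma pr1_pred : pr1 predn.
Proof. by apply: (@pr1_rec _ 0 (fun x _ => x)) => //; exact: pr2_fst. Qed.

(** The recursion of [pr2_rec] runs on the first argument, so the subtrahend comes first. *)
Lemma pr2_sub : pr2 (fun x y => y - x).
Proof.
apply: (@pr2_rec _ id (fun _ r _ => r.-1)) => [||y|x y].
- exact: pr1_id.
- by apply: pr3_comp1; [exact: pr1_pred | exact: pr3_2].
- exact: subn0.
- exact: subnS.
Qed.

Lemma pr1_pos : pr1 (fun x => x != 0 : nat).
Proof. by apply: (@pr1_rec _ 0 (fun _ _ => 1)) => //; apply: pr2_comp1 (pr1_const _) pr2_fst. Qed.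

Lemma pr1_zero : pr1 (fun x => x == 0 : nat).
Proof. by apply: (@pr1_rec _ 1 (fun _ _ => 0)) => //; apply: pr2_comp1 (pr1_const _) pr2_fst. Qed.

(** Branching by arithmetic: the 0/1 values of the two tests select one summand. *)
Lemma prim_rec_if n (c a b : n.-tuple nat -> nat) :
  prim_rec orc c -> prim_rec orc a -> prim_rec orc b ->
  prim_rec orc (fun v => if c v != 0 then a v else b v).
Proof.
move=> pc pa pb.
apply: (@eq_prim_rec _ (fun v => (c v != 0) * a v + (c v == 0) * b v)).
  by move=> v; case: eqP => _ /=; rewrite ?mul1n ?addn0.
apply: prim_rec_comp2; first exact: pr2_add.
  by apply: prim_rec_comp2 pr2_mul _ _ => //; apply: prim_rec_comp1 pr1_pos _.
by apply: prim_rec_comp2 pr2_mul _ _ => //; apply: prim_rec_comp1 pr1_zero _.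
Qed.

Lemma pr1_if c a b : pr1 c -> pr1 a -> pr1 b -> pr1 (fun x => if c x != 0 then a x else b x).
Proof. exact: prim_rec_if. Qed.

Lemma pr3_if c a b : pr3 c -> pr3 a -> pr3 b ->
  pr3 (fun x y z => if c x y z != 0 then a x y z else b x y z).
Proof. exact: prim_rec_if. Qed.

Lemma pr1_odd : pr1 (fun x => odd x : nat).
Proof.
apply: (@pr1_rec _ 0 (fun _ r => r == 0 : nat)) => //.
  by apply: pr2_comp1 pr1_zero pr2_snd.
by move=> x /=; case: (odd x).
Qed.

Lemma pr1_half : pr1 half.
Proof.
apply: (@pr1_rec _ 0 (fun x r => odd x + r)) => //.
  by apply: pr2_comp2 pr2_add (pr2_comp1 pr1_odd pr2_fst) pr2_snd.
by move=> x /=; rewrite uphalf_half.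
Qed.

(** The cons of mathcomp's coding of lists: [pickle (x :: s)] is convertible to
    [code_cons (pickle x) (pickle s)]. *)
Definition code_cons n m := 2 ^ n * m.*2.+1.

Lemma pr2_code_cons : pr2 code_cons.
Proof.
have H : pr2 (fun n m => 2 ^ n * m).
  apply: (@pr2_rec _ id (fun _ r _ => r + r)) => [||y|x y].
  - exact: pr1_id.
  - by apply: pr3_comp2 pr2_add pr3_2 pr3_2.
  - by rewrite mul1n.
  - by rewrite expnS -mulnA mul2n addnn.
have D : pr2 (fun _ m => m.*2.+1).
  apply: pr2_comp1; first exact: pr_succ.
  by apply: eq_prim_rec (pr2_comp2 pr2_add pr2_snd pr2_snd) => v; rewrite addnn.
exact: (pr2_comp2 H pr2_fst D).
Qed.

(** Decoding by bounded iteration: a nonzero [x] bounds the exponent of 2 in it, so [x] halvings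
    reach the odd part, and the head is the number of stages at which the value is still even. *)
Definition strip k x := iter k (fun r => if odd r then r else r./2) x.
Definition code_tail x := (strip x x)./2.
Definition code_head x := \sum_(k < x) ~~ odd (strip k x).

Lemma pr2_strip : pr2 strip.
Proof.
apply: (@pr2_rec _ id (fun _ r _ => if odd r != 0 :> nat then r else r./2)) => //.
- exact: pr1_id.
- apply: pr3_if; last exact: pr3_comp1 pr1_half pr3_2.
    exact: pr3_comp1 pr1_odd pr3_2.
  exact: pr3_2.
- by move=> x y; rewrite /strip iterS eqb0 negbK.
Qed.

Lemma pr1_code_tail : pr1 code_tail.
Proof. exact: pr1_comp pr1_half (pr1_comp2 pr2_strip pr1_id pr1_id). Qed.

Lemma pr1_code_head : pr1 code_head.
Proof.
have H : pr2 (fun n x => \sum_(k < n) ~~ odd (strip k x)).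
  apply: (@pr2_rec _ (fun=> 0) (fun k r x => r + ((odd (strip k x) : nat) == 0))).
  - exact: pr1_const.
  - apply: pr3_comp2 pr2_add pr3_2 _; apply: pr3_comp1 pr1_zero _.
    apply: pr3_comp1 pr1_odd _; exact: pr3_comp2 pr2_strip pr3_1 pr3_3.
  - by move=> y; rewrite big_ord0.
  - by move=> x y; rewrite big_ord_recr /= eqb0.
exact: pr1_comp2 H pr1_id pr1_id.
Qed.

Lemma strip_code k n m : strip k (code_cons n m) = code_cons (n - k) m.
Proof.
rewrite /code_cons; elim: k => [|k IH]; first by rewrite subn0.
rewrite /strip iterS -/(strip _ _) IH subnS; case: (n - k) => [|l].
  by rewrite !mul1n oddS odd_double.
by rewrite expnS -mulnA mul2n odd_double doubleK.
Qed.

Lemma leq_code n m : n + m < code_cons n m.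
Proof.
have H := ltn_expl n (isT : 1 < 2).
rewrite /code_cons -addnn.
have : 1 <= 2 ^ n by lia.
nia.
Qed.

Lemma code_consK_tail n m : code_tail (code_cons n m) = m.
Proof.
rewrite /code_tail strip_code; have := leq_code n m => H.
have -> : n - code_cons n m = 0 by lia.
by rewrite /code_cons mul1n /= uphalf_double.
Qed.

Lemma code_consK_head n m : code_head (code_cons n m) = n.
Proof.
suff H N : n <= N -> \sum_(k < N) ~~ odd (strip k (code_cons n m)) = n.
  by apply: H; have := leq_code n m; lia.
move=> nN.
rewrite (eq_bigr (fun k : 'I_N => k < n : nat)); last first.
  move=> k _; rewrite strip_code /code_cons oddM oddS odd_double andbT oddX orbF.
  by rewrite subn_eq0 -ltnNge.
rewrite -(big_mkord xpredT (fun k => k < n : nat)) (big_cat_nat (n := n)) //=.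
rewrite big_nat (eq_bigr (fun=> 1)); last by move=> i /andP[_ ->].
rewrite -big_nat sum_nat_const_nat subn0 muln1 big_nat big1 ?addn0 //.
by move=> i /andP[ni _]; rewrite ltnNge ni.
Qed.

Lemma code_cons_neq0 n m : code_cons n m != 0.
Proof. by have := leq_code n m; case: code_cons. Qed.

(** * Primitive recursive functions between countable types *)

Implicit Types T U V W : countType.

(** Nothing is asked of [F] off the codes, which keeps composition simple; [prim_rec_coded] restores
    the value 0 there. *)
Definition primrec T U (f : T -> U) := exists2 F, pr1 F & forall t, F (pickle t) = pickle (f t).

Lemma pr_compose T U V (f : U -> V) (g : T -> U) : primrec f -> primrec g -> primrec (fun t => f (g t)).
Proof.
move=> [F pF HF] [G pG HG]; exists (fun x => F (G x)); first exact: pr1_comp.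
by move=> t; rewrite HG HF.
Qed.

Lemma pr_var T : primrec (fun t : T => t). Proof. by exists id => //; exact: pr1_id. Qed.

Lemma pr_const T U (u : U) : primrec (fun _ : T => u).
Proof. by exists (fun=> pickle u) => //; exact: pr1_const. Qed.

(** Types with the same codes are exchanged for free: options are coded as short lists, sums as
    pairs of options, tests as numbers, moves as lists of numbers. *)
Lemma pr_code T U V (a : T -> U) (f : T -> V) : (forall t, pickle (f t) = pickle (a t)) ->
  primrec a -> primrec f.
Proof. by move=> E [F pF HF]; exists F => // t; rewrite HF. Qed.

Lemma pr_nat1 T F (a : T -> nat) : pr1 F -> primrec a -> primrec (fun t => F (a t)).
Proof. by move=> pF [G pG HG]; exists (fun x => F (G x)); [exact: pr1_comp | move=> t; rewrite HG]. Qed.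

Lemma pr_nat2 T F (a b : T -> nat) : pr2 F -> primrec a -> primrec b -> primrec (fun t => F (a t) (b t)).
Proof.
move=> pF [G pG HG] [H pH HH]; exists (fun x => F (G x) (H x)); first exact: pr1_comp2.
by move=> t; rewrite HG HH.
Qed.

Lemma pr_pickle T U (a : T -> U) : primrec a -> primrec (fun t => pickle (a t)).
Proof. exact: pr_code. Qed.

Lemma pr_S T (a : T -> nat) : primrec a -> primrec (fun t => (a t).+1).
Proof. exact/pr_nat1/pr_succ. Qed.
Lemma pr_add T (a b : T -> nat) : primrec a -> primrec b -> primrec (fun t => a t + b t).
Proof. exact/(pr_nat2 pr2_add). Qed.
Lemma pr_mul T (a b : T -> nat) : primrec a -> primrec b -> primrec (fun t => a t * b t).
Proof. exact/(pr_nat2 pr2_mul). Qed.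

Lemma pr_if T U (c : T -> bool) (a b : T -> U) : primrec c -> primrec a -> primrec b ->
  primrec (fun t => if c t then a t else b t).
Proof.
move=> [C pC HC] [F pF HF] [G pG HG].
exists (fun x => if C x != 0 then F x else G x); first exact: pr1_if.
by move=> t; rewrite HC HF HG /=; case: (c t).
Qed.

Lemma pr_eqnat T (a b : T -> nat) : primrec a -> primrec b -> primrec (fun t => a t == b t).
Proof.
move=> pa pb.
apply: (@pr_code _ nat _ (fun t => ((a t - b t) + (b t - a t) == 0 : nat))).
  by move=> t /=; congr (nat_of_bool _); rewrite addn_eq0 !subn_eq0 -eqn_leq.
apply: pr_nat1 pr1_zero _; apply: pr_add.
  exact: pr_nat2 pr2_sub pb pa.
exact: pr_nat2 pr2_sub pa pb.
Qed.

Lemma pr_eq T U (a b : T -> U) : primrec a -> primrec b -> primrec (fun t => a t == b t).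
Proof.
move=> pa pb; apply: (@pr_code _ _ _ (fun t => pickle (a t) == pickle (b t))).
  by move=> t; rewrite (inj_eq (pcan_inj pickleK)).
by apply: pr_eqnat; apply: pr_pickle.
Qed.

Lemma pr_ltn T (a b : T -> nat) : primrec a -> primrec b -> primrec (fun t => a t < b t).
Proof.
move=> pa pb.
apply: (@pr_code _ bool _ (fun t => (a t).+1 - b t == 0 )).
  by move=> t /=; rewrite subn_eq0.
apply: pr_eqnat; last exact: pr_const.
exact: pr_nat2 pr2_sub pb (pr_S pa).
Qed.

Lemma pr_not T (a : T -> bool) : primrec a -> primrec (fun t => ~~ a t).
Proof.
move=> pa; have := pr_if pa (@pr_const T bool false) (@pr_const T bool true).
exact: pr_code.
Qed.

Lemma pr_or T (a b : T -> bool) : primrec a -> primrec b -> primrec (fun t => a t || b t).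
Proof. by move=> pa pb; apply: pr_if => //; exact: pr_const. Qed.

Lemma pr_and T (a b : T -> bool) : primrec a -> primrec b -> primrec (fun t => a t && b t).
Proof. by move=> pa pb; apply: pr_if => //; exact: pr_const. Qed.

(** A pair is coded as the list of the codes of its two components. *)
Let code_pair x y := code_cons x (code_cons y 0).

Let pr2_code_pair : pr2 code_pair.
Proof.
apply: pr2_comp2 pr2_code_cons pr2_fst _; apply: pr2_comp2 pr2_code_cons pr2_snd _.
exact: pr2_comp1 (pr1_const 0) pr2_fst.
Qed.

Lemma pr_pair T U V (a : T -> U) (b : T -> V) : primrec a -> primrec b -> primrec (fun t => (a t, b t)).
Proof.
move=> [F pF HF] [G pG HG]; exists (fun x => code_pair (F x) (G x)).
  exact: pr1_comp2 pr2_code_pair pF pG.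
by move=> t; rewrite HF HG.
Qed.

Lemma pr_fst T U V (a : T -> U * V) : primrec a -> primrec (fun t => (a t).1).
Proof.
move=> [F pF HF]; exists (fun x => code_head (F x)); first exact: pr1_comp pr1_code_head pF.
by move=> t; rewrite HF; case: (a t) => x y /=; rewrite -[LHS]/(code_head (code_cons _ _)) code_consK_head.
Qed.

Lemma pr_snd T U V (a : T -> U * V) : primrec a -> primrec (fun t => (a t).2).
Proof.
move=> [F pF HF]; exists (fun x => code_head (code_tail (F x))).
  exact: pr1_comp pr1_code_head (pr1_comp pr1_code_tail pF).
move=> t; rewrite HF; case: (a t) => x y /=.
by rewrite -[LHS]/(code_head (code_tail (code_cons _ (code_cons _ _)))) code_consK_tail code_consK_head.
Qed.

Ltac prv := first [exact: pr_var | apply: pr_fst; prv | apply: pr_snd; prv | apply: pr_pair; prv].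

Lemma pr_cons T U (a : T -> U) (b : T -> seq U) : primrec a -> primrec b -> primrec (fun t => a t :: b t).
Proof.
move=> [F pF HF] [G pG HG]; exists (fun x => code_cons (F x) (G x)).
  exact: pr1_comp2 pr2_code_cons pF pG.
by move=> t; rewrite HF HG.
Qed.

(** The code 0 belongs to the empty list only, so it serves as the test. *)
Lemma pr_seq_case T U V (a : T -> seq U) (g : T -> V) (h : T -> U -> seq U -> V) :
  primrec a -> primrec g -> primrec (fun u : T * (U * seq U) => h u.1 u.2.1 u.2.2) ->
  primrec (fun t => match a t with [::] => g t | x :: s => h t x s end).
Proof.
move=> [F pF HF] [G pG HG] [H pH HH].
exists (fun x => if F x != 0 then
   H (code_pair x (code_pair (code_head (F x)) (code_tail (F x)))) else G x).
  apply: pr1_if => //; apply: pr1_comp pH _.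
  apply: pr1_comp2 pr2_code_pair pr1_id _.
  apply: pr1_comp2 pr2_code_pair _ _.
    exact: pr1_comp pr1_code_head pF.
  exact: pr1_comp pr1_code_tail pF.
move=> t; rewrite HF; case: (a t) => [|x s] /=; first by rewrite HG.
rewrite -[pickle (x :: s)]/(code_cons (pickle x) (pickle s)) code_cons_neq0.
by rewrite code_consK_tail code_consK_head -(HH (t, (x, s))).
Qed.

Lemma pr_some T U (a : T -> U) : primrec a -> primrec (fun t => Some (a t)).
Proof.
move=> pa; apply: (@pr_code _ _ _ (fun t => [:: a t])) => //.
by apply: pr_cons => //; exact: pr_const.
Qed.

Lemma pr_option_case T U V (a : T -> option U) (g : T -> V) (h : T -> U -> V) :
  primrec a -> primrec g -> primrec (fun u : T * U => h u.1 u.2) ->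
  primrec (fun t => match a t with None => g t | Some x => h t x end).
Proof.
move=> pa pg ph.
have pa' : primrec (fun t => if a t is Some x then [:: x] else [::]).
  by apply: pr_code pa => t; case: (a t).
have := @pr_seq_case _ _ _ _ g (fun t x _ => h t x) pa' pg.
have -> : (fun t => match (if a t is Some x then [:: x] else [::]) with
   [::] => g t | x :: _ => h t x end) = (fun t => match a t with None => g t | Some x => h t x end).
  by apply: funext => t; case: (a t).
apply; apply: (@pr_compose _ _ _ (fun u : T * U => h u.1 u.2)
  (fun u : T * (U * seq U) => (u.1, u.2.1))) => //.
prv.
Qed.

Lemma pr_inr T U V (a : T -> V) : primrec a -> primrec (fun t => inr (a t) : U + V)%type.
Proof.
move=> pa; apply: (@pr_code _ _ _ (fun t => (@None U, Some (a t)))) => //.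
by apply: pr_pair; [exact: pr_const | exact: pr_some].
Qed.

Lemma pr_sum_case T U V W (a : T -> (U + V)%type) (g : T -> U -> W) (h : T -> V -> W) :
  primrec a -> primrec (fun u : T * U => g u.1 u.2) -> primrec (fun u : T * V => h u.1 u.2) ->
  primrec (fun t => match a t with inl x => g t x | inr x => h t x end).
Proof.
move=> pa pg ph.
pose o t := match a t with inl x => (Some x, @None V) | inr y => (@None U, Some y) end.
have po : primrec o by apply: pr_code pa => t; rewrite /o; case: (a t).
(* The impossible case of two [None] needs a default in [W]. If [W] is empty, then so is [T], and
   any function will do. *)
have [[w _]|nW] := pselect (exists w : W, True); last first.
  exists id; first exact: pr1_id.
  by move=> t; case: (a t) => x; case: nW; [exists (g t x) | exists (h t x)].
have := @pr_option_case _ _ _ (fun t => (o t).1)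
  (fun t => match (o t).2 with Some y => h t y | None => w end) g (pr_fst po) _ pg.
have -> : (fun t => match (o t).1 with Some x => g t x | None =>
    match (o t).2 with Some y => h t y | None => w end end) =
   (fun t => match a t with inl x => g t x | inr x => h t x end).
  by apply: funext => t; rewrite /o; case: (a t).
by apply; apply: pr_option_case ph; [exact: pr_snd | exact: pr_const].
Qed.

Lemma pr_iter T U (k : T -> nat) (g : T -> U) (h : T -> U -> U) :
  primrec k -> primrec g -> primrec (fun u : T * U => h u.1 u.2) ->
  primrec (fun t => iter (k t) (h t) (g t)).
Proof.
move=> [K pK HK] [G pG HG] [H pH HH].
pose f n x := iter n (fun r => H (code_pair x r)) (G x).
exists (fun x => f (K x) x).
  apply: pr1_comp2 _ pK pr1_id.
  apply: (@pr2_rec _ G (fun _ r x => H (code_pair x r))) => //.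
  by apply: pr3_comp1 pH _; apply: pr3_comp2 pr2_code_pair pr3_3 pr3_2.
move=> t; rewrite HK /f /=; elim: (k t) => [|n IH] /=; first exact: HG.
by rewrite IH; exact: (HH (t, _)).
Qed.

Lemma size_leq_pickle T (s : seq T) : size s <= pickle s.
Proof.
elim: s => //= x s IH; apply: leq_ltn_trans IH _.
rewrite -[pickle (x :: s)]/(code_cons (pickle x) (pickle s)).
by have := leq_code (pickle x) (pickle s); lia.
Qed.

(** The code of a list bounds its length, so it can serve as the number of iterations; once the list
    is consumed, the surplus ones are idle. *)
Lemma pr_foldl T U V (a : T -> seq U) (g : T -> V) (h : T -> V -> U -> V) :
  primrec a -> primrec g -> primrec (fun u : T * (V * U) => h u.1 u.2.1 u.2.2) ->
  primrec (fun t => foldl (h t) (g t) (a t)).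
Proof.
move=> pa pg ph.
pose st t (z : seq U * V) := if z.1 is x :: s then (s, h t z.2 x) else z.
have E t k s v : size s <= k -> iter k (st t) (s, v) = ([::], foldl (h t) v s).
  elim: k s v => [|k IH] [|x s] v // H; rewrite iterSr {2}/st /=; first exact: IH.
  by rewrite IH.
have -> : (fun t => foldl (h t) (g t) (a t)) = (fun t => (iter (pickle (a t)) (st t) (a t, g t)).2).
  by apply: funext => t; rewrite E //= size_leq_pickle.
apply: pr_snd; apply: pr_iter; first exact: pr_pickle.
  exact: pr_pair.
apply: (@pr_seq_case _ _ _ (fun u : T * (seq U * V) => u.2.1) (fun u => u.2)
  (fun u x s => (s, h u.1 u.2.2 x))); [prv | prv |].
apply: pr_pair; first prv.
apply: (@pr_compose _ _ _ (fun u : T * (V * U) => h u.1 u.2.1 u.2.2)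
   (fun u : (T * (seq U * V)) * (U * seq U) => (u.1.1, (u.1.2.2, u.2.1)))) => //.
prv.
Qed.

(** Search as a counter that stops at the first success; [N t] increments without success give the
    value [N t] of a failing [find]. *)
Lemma pr_find T (N : T -> nat) (P : T -> pred nat) :
  primrec N -> primrec (fun u : T * nat => P u.1 u.2) -> primrec (fun t => find (P t) (iota 0 (N t))).
Proof.
move=> pN pP.
have -> : (fun t => find (P t) (iota 0 (N t))) =
   (fun t => iter (N t) (fun z => if P t z then z else z.+1) 0).
  apply: funext => t; elim: (N t) => // n IH.
  rewrite -addn1 iotaD find_cat IH addn1 iterS -IH /= add0n size_iota.
  case: ifP => H; last first.
    rewrite hasNfind ?H // size_iota; case: (P t n); lia.
  have /(nth_find 0) := H; rewrite nth_iota ?add0n => [->//|].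
  by have := H; rewrite has_find size_iota.
apply: pr_iter => //; first exact: pr_const.
apply: pr_if => //; first by prv.
by apply: pr_S; prv.
Qed.

Lemma pr_has T U (a : T -> seq U) (P : T -> pred U) :
  primrec a -> primrec (fun u : T * U => P u.1 u.2) -> primrec (fun t => has (P t) (a t)).
Proof.
move=> pa pP.
have -> : (fun t => has (P t) (a t)) = (fun t => foldl (fun b x => b || P t x) false (a t)).
  apply: funext => t; rewrite -[LHS]orFb; elim: (a t) false => [|x s IH] b /=; first exact: orbF.
  by rewrite orbA IH.
apply: pr_foldl => //; first exact: pr_const.
apply: pr_or; first by prv.
apply: (@pr_compose _ _ _ (fun u : T * U => P u.1 u.2)
  (fun u : T * (bool * U) => (u.1, u.2.2))) => //.
prv.
Qed.

Lemma pr_size T U (a : T -> seq U) : primrec a -> primrec (fun t => size (a t)).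
Proof.
move=> pa; have -> : (fun t => size (a t)) = (fun t => foldl (fun n _ => n.+1) 0 (a t)).
  apply: funext => t; rewrite -[LHS]add0n; elim: (a t) 0 => [|x s IH] n /=; first exact: addn0.
  by rewrite -IH; lia.
by apply: pr_foldl => //; [exact: pr_const | apply: pr_S; prv].
Qed.

Lemma pr_rev T U (a : T -> seq U) : primrec a -> primrec (fun t => rev (a t)).
Proof.
move=> pa; have -> : (fun t => rev (a t)) = (fun t => foldl (fun s x => x :: s) [::] (a t)).
  apply: funext => t; rewrite -[LHS]cats0; elim: (a t) [::] => [|x s IH] n //=.
  by rewrite rev_cons cat_rcons IH.
apply: pr_foldl => //; first exact: pr_const.
by apply: pr_cons; [prv|prv].
Qed.

Lemma pr_rcons T U (a : T -> seq U) (b : T -> U) : primrec a -> primrec b -> primrec (fun t => rcons (a t) (b t)).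
Proof.
move=> pa pb; have -> : (fun t => rcons (a t) (b t)) = (fun t => rev (b t :: rev (a t))).
  by apply: funext => t; rewrite rev_cons revK.
by apply: pr_rev; apply: pr_cons => //; apply: pr_rev.
Qed.

Lemma pr_behead T U (a : T -> seq U) : primrec a -> primrec (fun t => behead (a t)).
Proof.
move=> pa.
have := @pr_seq_case _ _ _ a (fun=> [::]) (fun _ _ s => s) pa (pr_const _ _).
have -> : (fun t => match a t with [::] => [::] | _ :: s => s end) = (fun t => behead (a t)).
  by apply: funext => t; case: (a t).
by apply; prv.
Qed.

Lemma pr_drop T U (n : T -> nat) (a : T -> seq U) : primrec n -> primrec a -> primrec (fun t => drop (n t) (a t)).
Proof.
move=> pn pa; have -> : (fun t => drop (n t) (a t)) = (fun t => iter (n t) behead (a t)).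
  apply: funext => t; elim: (n t) (a t) => [|k IH] s; first by rewrite drop0.
  by rewrite iterSr -IH; case: s.
by apply: pr_iter => //; apply: pr_behead; prv.
Qed.

Lemma pr_nth T U (x : U) (a : T -> seq U) (n : T -> nat) : primrec a -> primrec n -> primrec (fun t => nth x (a t) (n t)).
Proof.
move=> pa pn; have := @pr_seq_case _ _ _ (fun t => drop (n t) (a t)) (fun=> x) (fun _ y _ => y)
  (pr_drop pn pa) (pr_const _ _).
have -> : (fun t => match drop (n t) (a t) with [::] => x | y :: _ => y end) = (fun t => nth x (a t) (n t)).
  by apply: funext => t; rewrite -[n t in RHS]addn0 -nth_drop; case: drop.
by apply; prv.
Qed.

(** A case distinction with [N] branches, so [F k] need not be uniform in [k]. This is how finitely
    many games are queried through separate oracles. *)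
Lemma pr_below T U N (F : nat -> T -> U) (u : U) (i : T -> nat) : primrec i ->
  (forall k, k < N -> primrec (F k)) -> primrec (fun t => if i t < N then F (i t) t else u).
Proof.
move=> pi; elim: N => [|N IH] pF; first exact: pr_const.
have -> : (fun t => if i t < N.+1 then F (i t) t else u) =
  (fun t => if i t == N then F N t else if i t < N then F (i t) t else u).
  by apply: funext => t; rewrite ltnS leq_eqVlt; case: eqP => [->|].
apply: pr_if; first by apply: pr_eq => //; exact: pr_const.
  exact: pF.
by apply: IH => k kN; apply: pF; lia.
Qed.

Lemma pr_coded T U (f : T -> U) : orc (coded f) -> primrec f.
Proof.
move=> of_; exists (coded f); first exact: pr_oracle.
by move=> t; rewrite /coded pickleK_inv.
Qed.

Lemma pr_gmove T (a : T -> gmove) : primrec (fun t => gmove_code (a t)) -> primrec a.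
Proof. by apply: pr_code => t; case: (a t). Qed.

Lemma pr_Just T (a b : T -> nat) : primrec a -> primrec b -> primrec (fun t => Just (a t) (b t)).
Proof.
move=> pa pb; apply: pr_gmove; apply: pr_cons; first exact: pr_const.
apply: pr_cons => //; apply: pr_cons => //; exact: pr_const.
Qed.
Lemma pr_Em T (a b : T -> nat) : primrec a -> primrec b -> primrec (fun t => Em (a t) (b t)).
Proof.
move=> pa pb; apply: pr_gmove; apply: pr_cons; first exact: pr_const.
apply: pr_cons => //; apply: pr_cons => //; exact: pr_const.
Qed.
Lemma pr_Drop T (a : T -> nat) : primrec a -> primrec (fun t => Drop (a t)).
Proof.
move=> pa; apply: pr_gmove; apply: pr_cons; first exact: pr_const.
apply: pr_cons => //; exact: pr_const.
Qed.
Lemma pr_Stop T (a : T -> nat) : primrec a -> primrec (fun t => Stop (a t)).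
Proof.
move=> pa; apply: pr_gmove; apply: pr_cons; first exact: pr_const.
apply: pr_cons => //; exact: pr_const.
Qed.

End PrimRec.

(** * Games *)

Lemma mkseqSl (T : Type) (f : nat -> T) k : mkseq f k.+1 = f 0 :: mkseq (fun x => f x.+1) k.
Proof. by rewrite /mkseq /= -[1]addn0 iotaDl -map_comp. Qed.

Lemma shift_double (T : Type) (f : nat -> T) K :
  (fun x => f (K.+1.*2 + x)) = (fun x => f (K.*2 + x.+2)).
Proof. by apply: funext => x; congr f; lia. Qed.

(** Matches the recursion of [quant_pos], which reads one round, that is two moves, at a time. *)
Lemma pair_ind (T : Type) (P : seq T -> Prop) :
  P [::] -> (forall x, P [:: x]) -> (forall x y s, P s -> P [:: x, y & s]) ->
  forall s, P s.
Proof.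
move=> P0 P1 P2 s; have [n] := ubnP (size s); elim: n s => // n IH [|x [|y s]] //= sn.
by apply: P2; apply: IH; lia.
Qed.

Section Games.
Variable A : params.
Implicit Types (I F : set A) (L Ss : seq (game A)) (G : game A).

Lemma subgame_nil G : subgame G [::] = G.
Proof.
have E f : prepend [::] f = f by apply: funext => k; rewrite /prepend subn0 nth_nil.
case: G => p c t w i; rewrite /subgame /=.
have -> : (fun g => [set f | i g (prepend [::] f)]) = i.
  by apply: funext => g; rewrite predeqE => f /=; rewrite E.
by [].
Qed.

Lemma prepend_cat x y f : prepend x (prepend y f) = prepend (x ++ y) f.
Proof.
apply: funext => k; rewrite /prepend nth_cat size_cat subnDA.
case: ltnP => H; last by rewrite nth_default.
by apply: set_nth_default.
Qed.

Lemma subgame_cat G x y : subgame (subgame G x) y = subgame G (x ++ y).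
Proof.
congr Game; try by apply: funext => s /=; rewrite catA.
by apply: funext => g; rewrite predeqE => f /=; rewrite prepend_cat.
Qed.

Lemma pos_nil G : is_game G -> pos G [::]. Proof. by case=> -[]. Qed.

Lemma pos_pre G s t : is_game G -> pos G (s ++ t) -> pos G s.
Proof. by case=> -[_ H] _ _ _; apply: H. Qed.

Lemma nonatomic_child G : is_game G -> ~ atomic G -> exists m, pos G [:: m].
Proof.
move=> gG nG; apply: contrapT => H; apply: nG; rewrite /atomic predeqE => -[|m s] /=.
  by split=> // _; exact: pos_nil.
by split=> // pm; case: H; exists m; apply: (@pos_pre G [:: m] s).
Qed.

Lemma nonatomic_pos G m : pos G [:: m] -> ~ atomic G.
Proof. by move=> pm aG; have : pos G [:: m] by []; rewrite aG. Qed.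

Lemma atomic_leaf G : is_game G -> atomic G <-> leaf G [::].
Proof.
move=> gG; split=> [aG|[_ H]].
  by split; [exact: pos_nil | case=> m pm; apply: (@nonatomic_pos G m)].
by apply: contrapT => /(nonatomic_child gG)[m pm]; apply: H; exists m.
Qed.

Lemma nonatomic_nonleaf G : is_game G -> ~ atomic G <-> nonleaf G [::].
Proof.
move=> gG; split=> [nG|[_ [m pm]]]; last exact: nonatomic_pos pm.
by split; [exact: pos_nil | exact: nonatomic_child].
Qed.

Lemma assign_is_game I eta G : is_game G -> is_game (assign I eta G).
Proof. by case: G => p c t w i []; split. Qed.

(** The two strategies are played against each other: the play ends in a leaf with two winners, or
    is infinite and lies in both parts of the partition. *)
Lemma no_two_winners G S S' : is_game G ->
  g_winning G PlayerP S -> g_winning G PlayerO S' -> False.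
Proof.
move=> gG [[[[[TS Spos] Scl] Stot] Swin] Sinf] [[[[[TS' Spos'] Scl'] Stot'] Swin'] Sinf'].
(* At a common non-leaf one strategy offers a move of its player and the other admits all of them.
   Off the common nodes [Drop 0] is a dummy. *)
have step p : exists m, S p /\ S' p -> S (rcons p m) /\ S' (rcons p m).
  have [[Sp Sp']|] := pselect (S p /\ S' p); last by exists (Drop 0).
  have [nl|nl] := pselect (exists m, pos G (rcons p m)); last first.
    have lp : leaf G p by split=> //; exact: Spos.
    by have := Swin _ Sp lp; rewrite (Swin' _ Sp' lp).
  have nlp : nonleaf G p by split=> //; exact: Spos.
  case E: (turn G p).
    have [m Sm] := Stot _ Sp nlp E; exists m => _; split=> //.
    by apply: Scl' => //; exact: Spos.
  have [m Sm] := Stot' _ Sp' nlp E; exists m => _; split=> //.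
  by apply: Scl => //; exact: Spos'.
have [n Hn] := choice step.
pose h k := iter k (fun p => rcons p (n p)) [::].
pose f k := n (h k).
have E k : mkseq f k = h k by elim: k => //= k IH; rewrite mkseqS IH.
have H k : S (h k) /\ S' (h k).
  by elim: k => [|k IH]; [split; [case: TS | case: TS'] | exact: Hn].
have [_ _ GI _] := gG.
rewrite -[False]/(set0 f) -GI; split.
  by apply: Sinf => k; rewrite E; case: (H k).
by apply: Sinf' => k; rewrite E; case: (H k).
Qed.

(* When f k.*2 is a Just move for all k < K, hist L f K is the list of local
   positions after the first K rounds of the play f. *)
Fixpoint hist L (f : nat -> gmove) K :=
  if K is K'.+1 then
    if f K'.*2 is Just i _ then extend (hist L f K') i (f K'.*2.+1) else hist L f K'
  else L.

Definition justified n (f : nat -> gmove) K :=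
  forall k, k < K -> exists2 i, f k.*2 = Just i (n + k) & i < n + k.

Lemma justifiedW n f K K' : K' <= K -> justified n f K -> justified n f K'.
Proof. by move=> KK H k kK; apply: H; lia. Qed.

Lemma size_extend L i m : size (extend L i m) = (size L).+1.
Proof. by rewrite size_rcons. Qed.

Lemma size_hist L f K : justified (size L) f K -> size (hist L f K) = size L + K.
Proof.
elim: K => [|K IH] H /=; first by rewrite addn0.
have [i -> _] := H K (ltnSn K); rewrite size_extend IH ?addnS //.
exact: justifiedW H.
Qed.

Lemma loc_extend L i m j : j < size L -> loc (extend L i m) j = loc L j.
Proof. by move=> jL; rewrite /loc nth_rcons jL. Qed.

Lemma loc_extend_size L i m : loc (extend L i m) (size L) = subgame (loc L i) [:: m].
Proof. by rewrite /loc nth_rcons ltnn eqxx. Qed.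

(** Rounds only append positions, and [j.+1] rounds of [Just] moves create more than [j] of them, so
    position [j] is read off without fixing how long the play is. *)
Definition posn L f j := loc (hist L f j.+1) j.

Lemma size_hist_mono L f K K' : K <= K' -> size (hist L f K) <= size (hist L f K').
Proof.
elim: K' => [|K' IH] KK; first by move: KK; rewrite leqn0 => /eqP ->.
move: KK; rewrite leq_eqVlt => /orP[/eqP -> //|KK].
by apply: leq_trans (IH _) _ => //=; case: (f K'.*2) => *; rewrite ?size_extend.
Qed.

Lemma loc_hist_mono L f K K' j : K <= K' -> j < size (hist L f K) ->
  loc (hist L f K') j = loc (hist L f K) j.
Proof.
elim: K' => [|K' IH] KK jK; first by move: KK; rewrite leqn0 => /eqP ->.
move: KK; rewrite leq_eqVlt => /orP[/eqP -> //|KK] /=.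
rewrite -IH //; case: (f K'.*2) => // i q; apply: loc_extend.
exact: leq_trans jK (size_hist_mono _ _ _).
Qed.

Lemma posnE L f K j : justified (size L) f K -> j < size L + K ->
  posn L f j = loc (hist L f K) j.
Proof.
move=> H jK; rewrite /posn; have [KK|KK] := leqP K j.+1.
  by apply: loc_hist_mono; rewrite ?size_hist.
apply/esym/loc_hist_mono; first exact: ltnW.
by rewrite size_hist; [lia | apply: justifiedW H; lia].
Qed.

Lemma posn_init L f j : j < size L -> posn L f j = loc L j.
Proof. by move=> jL; rewrite (@posnE _ _ 0) ?addn0. Qed.

Lemma posn_justifies L f i m j K : justified (size L) f K -> j < size L + K ->
  justifies (size L) f i m j -> i < j /\ posn L f j = subgame (posn L f i) [:: m].
Proof.
move=> H jK [k [E E1 E2]]; rewrite {}E in E1 E2 jK *.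
have [i' E3 i'k] := H k ltac:(lia); move: E3; rewrite E1 => -[E3]; rewrite -{}E3 in i'k.
split=> //.
have Hk : justified (size L) f k by apply: justifiedW H; lia.
have Hk1 : justified (size L) f k.+1 by apply: justifiedW H; lia.
rewrite (posnE Hk1) ?addnS //= E1 E2 (posnE Hk) //.
by rewrite -[size L + k](size_hist Hk) loc_extend_size.
Qed.

(** Makes a thread of the play comparable with a branch of the game in which it starts. *)
Lemma posn_chain L f q i (j : nat -> nat) : (forall K, justified (size L) f K) ->
  j 0 = i -> (forall s, justifies (size L) f (j s) (q s) (j s.+1)) ->
  forall s, posn L f (j s) = subgame (posn L f i) (mkseq q s).
Proof.
move=> H j0 Hj; elim=> [|s IH]; first by rewrite subgame_nil j0.
have jK : j s.+1 < size L + (j s.+1).+1 by lia.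
have [_ ->] := posn_justifies (H _) jK (Hj s).
by rewrite IH subgame_cat mkseqS -cats1.
Qed.

(** DROP, EM and STOP end the play, so an infinite play has only [Just] rounds. The induction
    carries the local positions reached together with the rest of the play. *)
Lemma quant_pos_hist I F L f : (forall r, quant_pos I F L (mkseq f r)) ->
  forall K, justified (size L) f K.
Proof.
move=> H.
suff HK K r : justified (size L) f K /\
   quant_pos I F (hist L f K) (mkseq (fun x => f (K.*2 + x)) r) by move=> K; case: (HK K 0).
elim: K r => [|K IH] r; first by split.
have [J0 _] := IH 0.
have := (IH r.+2).2; rewrite !mkseqSl /= addn0 addn1 => -[].
case E: (f K.*2) => [||| i q|] //; rewrite /P_move size_hist // => -[iL qE _] [_ Q].
rewrite shift_double; split=> //.
move=> k; rewrite ltnS leq_eqVlt => /orP[/eqP ->|]; last exact: J0.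
by exists i; rewrite ?E ?qE.
Qed.

(* Ss is a list of games whose trees are the local strategies of player O; they
   are carried along the play in the same way as the local positions in L. *)
Fixpoint combine I F L (Ss : seq (game A)) (p : seq gmove) : Prop :=
  match p with
  | [::] => True
  | [:: m] => P_move I F L m
  | m :: m' :: p' =>
      P_move I F L m /\
      if m is Just i _ then
        [/\ pos (loc L i) [:: m'], pos (loc Ss i) [:: m']
          & combine I F (extend L i m') (extend Ss i m') p']
      else False
  end.

Lemma combine_pos I F L Ss p : combine I F L Ss p -> quant_pos I F L p.
Proof.
elim/pair_ind: p L Ss => // m m' p IH L Ss /= [Pm H]; split=> //.
by case: m Pm H => // i q _ [? _ /IH].
Qed.

Lemma combine_pre I F L Ss s t : combine I F L Ss (s ++ t) -> combine I F L Ss s.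
Proof.
elim/pair_ind: s L Ss => [|m|m m' s IH] L Ss //=; first by case: t => // ? ? [].
by case=> Pm H; split=> //; case: m Pm H => // i q _ [? ? /IH].
Qed.

Lemma combine_hist I F L Ss f : size Ss = size L ->
  (forall r, combine I F L Ss (mkseq f r)) ->
  forall i m j, justifies (size L) f i m j -> pos (posn Ss f i) [:: m].
Proof.
move=> sL H.
have jL := quant_pos_hist (fun r => combine_pos (H r)).
have jS K : justified (size Ss) f K by rewrite sL.
have HK K r : combine I F (hist L f K) (hist Ss f K) (mkseq (fun x => f (K.*2 + x)) r).
  elim: K r => [|K IH] r //.
  have := IH r.+2; rewrite !mkseqSl /= addn0 addn1 => -[_].
  case E: (f K.*2) => [||| i q|] // [_ _].
  by rewrite shift_double.
move=> i m j [k [E E1 E2]].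
have [i' E3 ik] := jL k.+1 k ltac:(lia); move: E3; rewrite E1 => -[E3 _]; rewrite -{}E3 in ik.
have := HK k 2; rewrite !mkseqSl /= addn0 addn1 E1 E2 => -[_ [_ Hp _]].
by rewrite (posnE (jS k)) // sL.
Qed.

Lemma g_partially_winning_subgame I eta G g S m :
  g_partially_winning (assign I eta G) g S -> S [:: m] ->
  g_partially_winning (assign I eta (subgame G [:: m])) g [set s | S (m :: s)].
Proof.
move=> [[[[[_ Spre] Spos] Scl] Stot] Swin] Sm; split; first split; first split; first split.
- by split=> // s t; apply: (Spre (m :: s)).
- by move=> s /Spos.
- by move=> p Sp nl t m' pm; apply: (Scl (m :: p)).
- by move=> p Sp nl t; apply: (Stot (m :: p)).
- by move=> p Sp lp; apply: (Swin (m :: p)).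
Qed.

(** * The O-strategy combined from local O-strategies *)

Section Combine.
Variables (I : set A) (eta : A -> player).
Hypotheses (Idual : selfdual I) (Ieta : assignment I eta).

(** Only partial winning is carried along the play: an infinite thread is judged in the initial game
    where it starts, not in the subgames it passes. *)
Definition local_O_strategies L Ss :=
  size Ss = size L /\ forall i, i < size L ->
   g_partially_winning (assign I eta (loc L i)) PlayerO (pos (loc Ss i)).

Lemma local_O_strategies_extend L Ss i m : local_O_strategies L Ss -> i < size L ->
  pos (loc Ss i) [:: m] -> local_O_strategies (extend L i m) (extend Ss i m).
Proof.
move=> [sz H] iL Sm; split; first by rewrite !size_extend sz.
move=> j; rewrite size_extend ltnS leq_eqVlt => /orP[/eqP ->|jL].
  rewrite -{2}sz !loc_extend_size; exact: g_partially_winning_subgame (H _ iL) Sm.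
by rewrite !loc_extend ?sz //; apply: H.
Qed.

(** [combine] restricts only the answers to [Just], and there a local O-strategy contains every move
    when the turn is P's. *)
Lemma combine_cl F L Ss p m : games L -> local_O_strategies L Ss -> combine I F L Ss p ->
  quant_turn L p = PlayerP -> quant_pos I F L (rcons p m) -> combine I F L Ss (rcons p m).
Proof.
elim/pair_ind: p L Ss => [|m0|m0 m1 p IH] L Ss gL oL //.
  case: m0 => [k|i j|i|i k|k]; try by move=> /= _ _ [].
  move=> /= [iL kE nL] t [_ [pm _]]; split=> //; split=> //.
  have [[[[[S0 _] _] Scl] _] _] := oL.2 _ iL.
  have nl : nonleaf (assign I eta (loc L i)) [::].
    by apply/nonatomic_nonleaf => //; exact/assign_is_game/gL.
  exact: (Scl [::] S0 nl t m pm).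
case: m0 => [k|i j|i|i k|k]; try by move=> /= [].
move=> /= [[iL qE nL] [pm Sm H]] t [_ [_ H']]; split=> //; split=> //.
by apply: IH => //; [exact: games_extend | exact: local_O_strategies_extend].
Qed.

Lemma combine_total F L Ss p : games L -> local_O_strategies L Ss -> combine I F L Ss p ->
  quant_turn L p = PlayerO -> exists m, combine I F L Ss (rcons p m).
Proof.
elim/pair_ind: p L Ss => [|m0|m0 m1 p IH] L Ss gL oL //.
  case: m0 => //= i k [iL kE nL] t.
  have [[[[[S0 _] Spos] _] Stot] _] := oL.2 _ iL.
  have nl : nonleaf (assign I eta (loc L i)) [::].
    by apply/nonatomic_nonleaf => //; exact/assign_is_game/gL.
  have [m Sm] := Stot [::] S0 nl t.
  by exists m; split=> //; split=> //; exact: Spos.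
case: m0 => [k|i j|i|i k|k]; try by move=> /= [].
move=> /= [[iL qE nL] [pm Sm H]] t.
have [m Hm] := IH _ _ (games_extend gL iL pm) (local_O_strategies_extend oL iL Sm) H t.
by exists m.
Qed.

Lemma is_END_leaf G l : is_game G -> is_END G l -> leaf (assign I eta G) [::].
Proof. by move=> gG [aG _]; apply/atomic_leaf => //; exact: assign_is_game. Qed.

(** At atomic positions the local strategies force the value O under [eta]. An EM move would force
    it for both [a] and [dual a], and a STOP move meets the label O; [F = set0] excludes stopping at
    a parameter. *)
Lemma combine_leaf F L Ss p : F = set0 -> games L -> local_O_strategies L Ss ->
  combine I F L Ss p -> ~ (exists m, quant_pos I F L (rcons p m)) -> quant_win L p = inl PlayerO.
Proof.
move=> F0; elim/pair_ind: p L Ss => [|m0|m0 m1 p IH] L Ss gL oL.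
- by move=> _ []; exists (Drop (size L)).
- have E i l : i < size L -> is_END (loc L i) l -> win (assign I eta (loc L i)) [::] = inl PlayerO.
    move=> iL Ei; have [[[[[S0 _] _] _] _] Swin] := oL.2 _ iL.
    by apply: Swin; [exact: S0 | apply: is_END_leaf Ei; exact: gL].
  case: m0 => //= [i j [iL jL [a [Ia Ei Ej]]] _|i [iL [[g Ei]|[a]]]].
  + have Ia' : I (dual a) by rewrite -Idual; exists a.
    have := E _ _ iL Ei; have := E _ _ jL Ej; rewrite /= Ei.2 Ej.2 !asboolT //.
    by rewrite (Ieta Ia) => -[Ea'] -[Ea]; rewrite Ea in Ea'.
  + by have := E _ _ iL Ei; rewrite /= Ei.2.
  + by rewrite F0.
- case: m0 => [k|i j|i|i k|k]; try by move=> /= [].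
  move=> /= [[iL qE nL] [pm Sm H]] nl; apply: (IH _ _ (games_extend gL iL pm) (local_O_strategies_extend oL iL Sm) H).
  by case=> m Hm; apply: nl; exists m.
Qed.

Lemma combine_winning L Ss : games L -> FVs L `\` I = set0 -> size Ss = size L ->
  (forall i, i < size L -> g_winning (assign I eta (loc L i)) PlayerO (pos (loc Ss i))) ->
  g_winning (quant I L) PlayerO (combine I (FVs L `\` I) L Ss).
Proof.
move=> gL F0 sz H; have oL : local_O_strategies L Ss by split=> // i /H[].
split; first split; first split; first split; first split.
- by split=> // s t; exact: combine_pre.
- by move=> p; exact: combine_pos.
- by move=> p Sp _ t m; apply: combine_cl.
- by move=> p Sp _ t; apply: combine_total t.
- by move=> p Sp [_ lp]; exact: combine_leaf F0 gL oL Sp lp.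
move=> f Hf; have Q r := combine_pos (Hf r).
(* The moves of a thread from [G_i] form a branch of the local strategy for [G_i]; that strategy is
   O-winning, so P cannot win the thread. *)
split=> // -[i [q [iL [j [j0 _ Hj]] qP]]].
have jS K : justified (size Ss) f K by rewrite sz; exact: quant_pos_hist Q K.
have Sq s : pos (loc Ss i) (mkseq q s.+1).
  have := combine_hist sz Hf (Hj s).
  have Hj' t : justifies (size Ss) f (j t) (q t) (j t.+1) by rewrite sz.
  by rewrite (posn_chain jS j0 Hj') posn_init ?sz //= mkseqS cats1.
have [_ Hinf] := H _ iL.
have [_ _ GI _] := gL _ iL; rewrite -[False]/(set0 q) -GI; split=> //.
apply: (Hinf q) => -[|s]; last exact: Sq.
by have [[[[[[]]]]]] := H _ iL.
Qed.

End Combine.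

(** * O-strategies read off an exhausted family of positions *)

Section Exhausted.
Variables (I : set A) (eta : A -> player) (D : nat -> Prop) (gl : nat -> game A)
  (Tr : nat -> gmove -> nat -> Prop).
Hypotheses
  (Tr_gl : forall j m k, D j -> Tr j m k -> D k /\ gl k = subgame (gl j) [:: m])
  (gl_game : forall j, D j -> is_game (gl j))
  (gl_atomic : forall j, D j -> atomic (gl j) ->
     win (assign I eta (gl j)) [::] = inl PlayerO)
  (Tr_P : forall j m, D j -> turn (gl j) [::] = PlayerP ->
     pos (gl j) [:: m] -> exists k, Tr j m k)
  (Tr_O : forall j m, D j -> turn (gl j) [::] = PlayerO -> pos (gl j) [:: m] ->
     exists m' k, Tr j m' k /\ pos (gl j) [:: m']).

(** [Tr] may lead from an index by one move to several indices. Following a choice function [K], the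
    moves alone determine the indices, so an infinite branch of the tree of paths yields a chain of
    [Tr]. *)
Lemma exhausted_O_winning j : D j ->
  ~ (exists (q : nat -> gmove) (c : nat -> nat),
      [/\ c 0 = j, forall s, Tr (c s) (q s) (c s.+1) & inf (gl j) PlayerP q]) ->
  exists S, g_winning (assign I eta (gl j)) PlayerO S.
Proof.
move=> Dj nP.
have [K HK] : exists K : nat * gmove -> nat, forall p, (exists k, Tr p.1 p.2 k) -> Tr p.1 p.2 (K p).
  have H (p : nat * gmove) : exists k, (exists k, Tr p.1 p.2 k) -> Tr p.1 p.2 k.
    have [[k Tk]|nk] := pselect (exists k, Tr p.1 p.2 k); first by exists k.
    by exists 0 => /nk.
  by have [K HK] := choice H; exists K.
pose path := fix path j q := if q is m :: q' then
   [/\ pos (gl j) [:: m], Tr j m (K (j, m)) & path (K (j, m)) q'] else True.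
have pathS i m q : D i -> path i (m :: q) ->
    D (K (i, m)) /\ gl (K (i, m)) = subgame (gl i) [:: m].
  by move=> Di [pm T _]; exact: Tr_gl T.
have path_pos i q : D i -> path i q -> pos (gl i) q.
  elim: q i => [|m q IH] i Di; first by move=> _; exact/pos_nil/gl_game.
  move=> H; have [Dk Ek] := pathS _ _ _ Di H; case: H => pm T /(IH _ Dk).
  by rewrite Ek.
exists (path j); split; first split; first split; first split; first split.
- split=> // s; elim: s j {Dj nP} => //= m s IH j t [pm T /IH H]; split=> //.
- by move=> p Hp; exact: path_pos.
- move=> p; elim: p j Dj {nP} => [|m q IH] j Dj Hp nl tP m' /= pm'.
    by split=> //; apply: (HK (j, m')); exact: Tr_P.
  have [Dk Ek] := pathS _ _ _ Dj Hp; case: Hp => pm T Hq; split=> //.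
  by apply: IH => //; rewrite Ek.
- move=> p; elim: p j Dj {nP} => [|m q IH] j Dj Hp nl tO.
    have [_ [m pm]] := nl; have [m' [k [T pm']]] := Tr_O Dj tO pm.
    by exists m'; split=> //; apply: (HK (j, m')); exists k.
  have [Dk Ek] := pathS _ _ _ Dj Hp; case: Hp => pm T Hq.
  have [||m' H] := IH _ Dk Hq; rewrite ?Ek //.
  by exists m'; split.
- move=> p; elim: p j Dj {nP} => [|m q IH] j Dj Hp lf.
    by apply: gl_atomic => //; apply/atomic_leaf; first exact: gl_game.
  have [Dk Ek] := pathS _ _ _ Dj Hp; case: Hp => pm T Hq.
  by have := IH _ Dk Hq; rewrite Ek; apply.
move=> f Hf.
have [_ _ _ GU] := gl_game Dj.
have : branches (pos (gl j)) f by move=> k; exact: path_pos (Hf k).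
rewrite -GU => -[fP|//]; case: nP; exists f.
pose c := fix c s := if s is s'.+1 then K (c s', f s') else j.
exists c; split=> // s.
(* The length 1 is generalised, since the induction on [s] needs longer pieces of the branch from
   [c s]. *)
suff : path (c s) (mkseq (fun x => f (s + x)) 1) by case; rewrite addn0.
elim: s 1 => [|s IH] r; first exact: Hf.
have := IH r.+1; rewrite mkseqSl addn0 => -[_ _] /=.
by rewrite (@eq_mkseq _ _ (fun x => f (s.+1 + x))) // => x; rewrite addnS.
Qed.

End Exhausted.

(** * The rules of [exh] and the axioms of a strategy *)

Section Exh.
Variable I : set A.

(** The clauses without a move must come to an end: after the current pass at most one more follows,
    up to [size L], and it ends with a move or with DROP. *)
Lemma exh_nil L i c J : i <= c -> c <= size L -> exh I L i c J [::].
Proof.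
move=> ic cL.
have H c' : c' <= size L -> (c' < size L -> exh I L 0 (size L) J [::]) ->
    forall k i, k + i = c' -> exh I L i c' J [::].
  move=> c'L H0; elim=> [|k IH] j jk.
    rewrite add0n in jk; rewrite jk; move: c'L; rewrite leq_eqVlt => /orP[/eqP E|lt].
      by rewrite E; apply: exh_drop; left.
    by apply: exh_repeat => //; exact: H0.
  have jc : j < c' by lia.
  have Hn : exh I L j.+1 c' J [::] by apply: IH; lia.
  have [aj|nj] := pselect (atomic (loc L j)); last first.
    have [[m mj]|nm] := pselect (exists m, try_move L J j m).
      by apply: exh_try_just mj _ => //; left.
    exact: exh_try_none.
  have [Pj|nP] := pselect (is_END (loc L j) (inl PlayerP)).
    by apply: exh_stop => //; left.
  have [[l El]|nE] := pselect (exists l, em_clause I L j c' l).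
    by apply: exh_em El _ => //; left.
  exact: exh_skip.
apply: (H c cL _ (c - i)); last by lia.
by move=> _; apply: (H (size L) _ _ (size L)) => //; [rewrite ltnn | lia].
Qed.

Lemma exh_pre L i c J s t : i <= c -> c <= size L -> exh I L i c J (s ++ t) -> exh I L i c J s.
Proof.
have pre1 (m : gmove) u v w : u = [::] \/ u = [:: m] -> v ++ w = u -> v = [::] \/ v = [:: m].
  by case=> ->; case: v => [|? [|]] //=; [left | left | case=> -> _; right].
move=> ic cL; move E: (s ++ t) => u H.
elim: H s E ic cL => {L i c J u}
  [L c J u cL H IH|L J u Hu|L i c J j u ic Ej Hu|L i c J u ic Pi Hu
  |L i c J u ic nE nP ai H IH|L i c J m u ic ni mi Hu|L i c J m u ic ni mi H IH
  |L i c J u ic ni nm H IH] s E ic' cL'.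
- by apply: exh_repeat => //; exact: IH.
- by apply: exh_drop; exact: pre1 Hu E.
- by apply: exh_em Ej _ => //; exact: pre1 Hu E.
- by apply: exh_stop Pi _ => //; exact: pre1 Hu E.
- by apply: exh_skip => //; exact: IH.
- by apply: exh_try_just mi _ => //; exact: pre1 Hu E.
- case: s E => [|m0 [|m1 s]] E; first exact: exh_nil.
    by apply: exh_try_just mi _ => //; case: E => -> _; right.
  case: E => -> -> E; apply: exh_try_move => //.
  by apply: (IH _ E); rewrite ?size_extend; lia.
- by apply: exh_try_none => //; exact: IH.
Qed.

Lemma try_move_pos L J i m : is_game (loc L i) -> try_move L J i m -> pos (loc L i) [:: m].
Proof.
move=> [_ /(_ [::])[E _ _] _ _]; rewrite /try_move; case: turn => [[k [Ek _ _]]|[]//].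
by apply/E; exists k.
Qed.

Lemma exh_pos F L i c J s : games L -> i <= c -> c <= size L -> exh I L i c J s ->
  quant_pos I F L s.
Proof.
move=> gL ic cL H.
elim: H gL ic cL => {L i c J s}
  [L c J u cL H IH|L J u Hu|L i c J j u ic Ej Hu|L i c J u ic Pi Hu
  |L i c J u ic nE nP ai H IH|L i c J m u ic ni mi Hu|L i c J m u ic ni mi H IH
  |L i c J u ic ni nm H IH] gL ic' cL'.
- exact: IH.
- by case: Hu => ->.
- case: Hu => -> //=; case: Ej => a [Ia Ei jc Ej _]; split; [lia | lia | by exists a].
- by case: Hu => -> //=; split; [lia | left; exists PlayerP].
- exact: IH.
- by case: Hu => -> //=; split=> //; lia.
- have iL : i < size L by lia.
  have pm := try_move_pos (gL _ iL) mi.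
  split; first by split.
  by split=> //; apply: IH; rewrite ?size_extend; [exact: games_extend | lia | lia].
- exact: IH.
Qed.

(** The turn is O's only after [Just] into a local position of O, where TRYALL (b) continues with
    every move from the root. *)
Lemma exh_cl F L i c J s m : i <= c -> c <= size L -> exh I L i c J s ->
  quant_turn L s = PlayerO -> quant_pos I F L (rcons s m) -> exh I L i c J (rcons s m).
Proof.
move=> ic cL H.
elim: H ic cL => {L i c J s}
  [L c J u cL H IH|L J u Hu|L i c J j u ic Ej Hu|L i c J u ic Pi Hu
  |L i c J u ic nE nP ai H IH|L i c J m0 u ic ni mi Hu|L i c J m0 u ic ni mi H IH
  |L i c J u ic ni nm H IH] ic' cL'.
- by move=> t p; apply: exh_repeat => //; exact: IH.
- by case: Hu => ->.
- by case: Hu => ->.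
- by case: Hu => ->.
- by move=> t p; apply: exh_skip => //; exact: IH.
- case: Hu => -> //= t [_ [pm _]]; apply: exh_try_move => //; last first.
    by apply: exh_nil; rewrite ?size_extend; lia.
  by move: mi; rewrite /try_move t => -[_ ?].
- by move=> t [_ [_ p]]; apply: exh_try_move => //; apply: IH; rewrite ?size_extend //; lia.
- by move=> t p; apply: exh_try_none => //; exact: IH.
Qed.

Lemma exh_total F L i c J s : i <= c -> c <= size L -> exh I L i c J s ->
  (exists m, quant_pos I F L (rcons s m)) ->
  quant_turn L s = PlayerP -> exists m, exh I L i c J (rcons s m).
Proof.
move=> ic cL H.
elim: H ic cL => {L i c J s}
  [L c J u cL H IH|L J u Hu|L i c J j u ic Ej Hu|L i c J u ic Pi Hu
  |L i c J u ic nE nP ai H IH|L i c J m0 u ic ni mi Hu|L i c J m0 u ic ni mi H IH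
  |L i c J u ic ni nm H IH] ic' cL' [m pm] t.
- have [||//|m' H'] := IH _ _ _ t; try lia; first by exists m.
  by exists m'; exact: exh_repeat.
- case: Hu pm => -> //= pm; last by case: pm.
  by exists (Drop (size L)); apply: exh_drop; right.
- case: Hu pm => -> //= pm; last by case: pm.
  by exists (Em i j); apply: exh_em Ej _ => //; right.
- case: Hu pm => -> //= pm; last by case: pm.
  by exists (Stop i); apply: exh_stop => //; right.
- have [||//|m' H'] := IH _ _ _ t; try lia; first by exists m.
  by exists m'; exact: exh_skip.
- case: Hu pm t => -> //= _ t.
    by exists (Just i (size L)); apply: exh_try_just mi _ => //; right.
  exists m0; apply: exh_try_move => //.
  by apply: exh_nil; rewrite ?size_extend; lia.
- have [|||m' H'] := IH _ _ _ t; rewrite ?size_extend; try lia.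
    by exists m; case: pm => _ [].
  by exists m'; exact: exh_try_move.
- have [||//|m' H'] := IH _ _ _ t; try lia; first by exists m.
  by exists m'; exact: exh_try_none.
Qed.

(* The state (i, c, J) passes position i without a move, so that i is
   exhausted with respect to J. *)
Definition passes L i c J :=
  [/\ ~ (exists j, em_clause I L i c j), ~ is_END (loc L i) (inl PlayerP)
    & atomic (loc L i) \/ ~ exists m, try_move L J i m].

Lemma atomic_END L i l : is_END (loc L i) l -> atomic (loc L i). Proof. by case. Qed.

Lemma nonatomic_passes L i c J : ~ atomic (loc L i) ->
  ~ (exists m, try_move L J i m) -> passes L i c J.
Proof.
move=> ni nm; split; [|by move=> /atomic_END|by right].
by case=> j [a [_ /atomic_END]].
Qed.

(** The two clauses that go on to [i.+1] without a move are merged into [passes]. *)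
Lemma exh_inv L i c J s : exh I L i c J s ->
 (i = c /\ c < size L /\ exh I L 0 (size L) J s) \/
 (i = c /\ c = size L /\ (s = [::] \/ s = [:: Drop (size L)])) \/
 (i < c /\ exists2 j, em_clause I L i c j & s = [::] \/ s = [:: Em i j]) \/
 (i < c /\ is_END (loc L i) (inl PlayerP) /\ (s = [::] \/ s = [:: Stop i])) \/
 (i < c /\ passes L i c J /\ exh I L i.+1 c J s) \/
 (i < c /\ ~ atomic (loc L i) /\ exists2 m, try_move L J i m &
    (s = [::] \/ s = [:: Just i (size L)] \/ exists2 s', s = [:: Just i (size L), m & s']
      & exh I (extend L i m) i.+1 c (rcons J (i, m, size L)) s')).
Proof.
case=> {L i c J s}
  [L c J s cL H|L J s Hs|L i c J j s ic Ej Hs|L i c J s ic Pi Hs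
  |L i c J s ic nE nP ai H|L i c J m s ic ni mi Hs|L i c J m s ic ni mi H
  |L i c J s ic ni nm H].
- by left.
- by right; left.
- by do 2!right; left; split=> //; exists j.
- by do 3!right; left.
- by do 4!right; left; split=> //; split=> //; split=> //; left.
- by do 5!right; split=> //; split=> //; exists m => //; case: Hs; auto.
- by do 5!right; split=> //; split=> //; exists m => //; right; right; exists s.
- by do 4!right; left; split=> //; split=> //; exact: nonatomic_passes.
Qed.

Lemma exh_inv2 L i c J m0 m1 s : exh I L i c J [:: m0, m1 & s] ->
  [\/ [/\ i = c, c < size L & exh I L 0 (size L) J [:: m0, m1 & s]],
      [/\ i < c, passes L i c J & exh I L i.+1 c J [:: m0, m1 & s]]
    | [/\ i < c, ~ atomic (loc L i), m0 = Just i (size L), try_move L J i m1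
        & exh I (extend L i m1) i.+1 c (rcons J (i, m1, size L)) s]].
Proof.
case/exh_inv=> [[? [? ?]]|[[_ [_ H]]|[[_ [j _ H]]|[[_ [_ H]]|[[? [? ?]]|[? [? [m tm H]]]]]]]].
- by constructor 1.
- by case: H.
- by case: H.
- by case: H.
- by constructor 2.
- by constructor 3; case: H => [|[|[s' [-> -> ->]]]].
Qed.

Lemma em_clause_exists L i c j a : I a -> is_END (loc L i) (inr a) -> j < c ->
  is_END (loc L j) (inr (dual a)) -> exists l, em_clause I L i c l.
Proof.
move=> Ia Ei jc Ej.
have ex : exists l, `[< is_END (loc L l) (inr (dual a)) >] by exists j; apply/asboolP.
case: (ex_minnP ex) => l /asboolP El lmin; exists l, a; split=> //.
  by apply: leq_ltn_trans jc; apply/lmin/asboolP.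
by move=> l' l'l /asboolP /lmin; rewrite leqNgt l'l.
Qed.

Lemma untried_first G J i k m : children G [::] k = Some m -> ~~ tried J i m ->
  exists m', first_untried G J i m'.
Proof.
move=> E nt.
have ex : exists k, oapp (fun m => ~~ tried J i m) false (children G [::] k).
  by exists k; rewrite E.
case: (ex_minnP ex) => l; case El: (children G [::] l) => [m'|] // nt' lmin.
exists m', l; split=> // k' m'' kl Ek'; apply: contrapT => /negP nt''.
by have := lmin k'; rewrite Ek' => /(_ nt''); rewrite leqNgt kl.
Qed.

(** Without a first untried move there is no untried move at all, by minimality in the
    enumeration. *)
Lemma passes_tried L J i c m : is_game (loc L i) -> passes L i c J ->
  turn (loc L i) [::] = PlayerP -> pos (loc L i) [:: m] -> tried J i m.
Proof.
move=> gG [_ _ H] tP pm; apply: contrapT => /negP nt.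
case: H => [|[]]; first exact: nonatomic_pos pm.
have [_ /(_ [::])[E _ _] _ _] := gG; have /E[k Ek] := pm.
by have [m' Hm'] := untried_first Ek nt; exists m'; rewrite /try_move tP.
Qed.

Lemma passes_has L J i c m : passes L i c J ->
  turn (loc L i) [::] = PlayerO -> pos (loc L i) [:: m] ->
  has (fun t : triple => t.1.1 == i) J.
Proof.
move=> [_ _ H] tO pm; apply: contrapT => /negP nt.
case: H => [|[]]; first exact: nonatomic_pos pm.
by exists m; rewrite /try_move tO.
Qed.

Definition labels_in G := forall p a, leaf G p -> win G p = inr a -> I a.

(** * Runs of EXH along a play *)

Section Play.
Variables (Gamma : seq (game A)) (f : nat -> gmove).
Hypotheses (Ggames : games Gamma)
  (Glabels : forall j, j < size Gamma -> labels_in (loc Gamma j)).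
Let n := size Gamma.
Local Notation H T := (hist Gamma f T).

(* A state of the computation of EXH which is reached after T rounds of f. *)
Record run T i c (J : seq triple) : Prop := Run {
  run_just : justified n f T;
  run_games : games (H T);
  run_labels : forall j, j < n + T -> labels_in (loc (H T) j);
  run_triples : forall a m k, (a, m, k) \in J -> justifies n f a m k /\ k < n + T;
  run_ic : i <= c;
  run_c : c <= n + T;
  run_passes : n + T = c -> forall j, j < i -> passes (H T) j c J }.

Lemma run0 : run 0 0 n [::].
Proof. by split=> //; rewrite addn0 //. Qed.

Lemma run_size T i c J : run T i c J -> size (H T) = n + T.
Proof. by move=> R; apply: size_hist; exact: run_just R. Qed.

Lemma run_repeat T c J : run T c c J -> c < n + T -> run T 0 (n + T) J.
Proof. by case=> *; split. Qed.

(** If [n + T = c], no move was made since the current pass began, so all passes recorded in it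
    refer to the same [H T] and [J]. *)
Lemma run_next T i c J : run T i c J -> i < c -> passes (H T) i c J -> run T i.+1 c J.
Proof.
case=> r1 r2 r3 r4 r5 r6 r7 ic pi; split=> // E j; rewrite ltnS leq_eqVlt => /orP[/eqP ->//|].
exact: r7.
Qed.

Lemma run_try T i c J : run T i c J -> i < c -> f T.*2 = Just i (n + T) ->
  try_move (H T) J i (f T.*2.+1) ->
  run T.+1 i.+1 c (rcons J (i, f T.*2.+1, n + T)).
Proof.
move=> R; have sz := run_size R; case: R => r1 r2 r3 r4 r5 r6 r7 ic fT tm.
have iL : i < size (H T) by rewrite sz; lia.
have pm := try_move_pos (r2 _ iL) tm.
have HS : H T.+1 = extend (H T) i (f T.*2.+1) by rewrite /= fT.
(* A move makes the number of positions exceed [c], so the premise of [run_passes] fails and earlier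
   passes are forgotten. *)
split; last by lia.
- move=> k; rewrite ltnS leq_eqVlt => /orP[/eqP ->|]; last exact: r1.
  by exists i => //; lia.
- by rewrite HS; exact: games_extend.
- move=> j; rewrite HS addnS ltnS leq_eqVlt => /orP[/eqP ->|jT].
    rewrite -sz loc_extend_size => p a lp; apply: (r3 i _ ((f T.*2.+1) :: p)) => //; lia.
  by rewrite loc_extend ?sz //; exact: r3.
- move=> a m k; rewrite mem_rcons inE => /orP[/eqP[-> -> ->]|/r4[]]; last by split=> //; lia.
  by split; [exists T | lia].
- by [].
- by lia.
Qed.

(* D is the set of indices of the local positions of the play f, and Tr is the
   relation of justification between them. *)
Section Lost.
Variables (D : nat -> Prop) (Tr : nat -> gmove -> nat -> Prop).
Let gl := posn Gamma f.
Hypotheses (D_init : forall j, j < n -> D j)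
  (D_game : forall j, D j -> is_game (gl j) /\ labels_in (gl j))
  (D_em : forall i j a, D i -> D j -> I a -> is_END (gl i) (inr a) ->
     ~ is_END (gl j) (inr (dual a)))
  (D_stop : forall j, D j -> ~ is_END (gl j) (inl PlayerP))
  (D_Tr : forall j m k, D j -> Tr j m k -> D k /\ gl k = subgame (gl j) [:: m])
  (D_P : forall j m, D j -> turn (gl j) [::] = PlayerP ->
     pos (gl j) [:: m] -> exists k, Tr j m k)
  (D_O : forall j m, D j -> turn (gl j) [::] = PlayerO -> pos (gl j) [:: m] ->
     exists m' k, Tr j m' k /\ pos (gl j) [:: m'])
  (D_inf : forall j q c, j < n -> c 0 = j -> (forall s, Tr (c s) (q s) (c s.+1)) ->
     ~ inf (gl j) PlayerP q).

Lemma lost_O_winning : exists2 eta, assignment I eta &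
  forall i, i < n -> exists S, g_winning (assign I eta (loc Gamma i)) PlayerO S.
Proof.
pose occ a := exists2 j, D j & is_END (gl j) (inr a).
(* Labels that occur go to O and their duals to P. If neither occurs, comparing codes is an
   arbitrary choice compatible with duality, since [a] and [dual a] differ. *)
pose eta a := if `[< occ a >] then PlayerO else if `[< occ (dual a) >] then PlayerP
  else player_of_bool (pickle a < pickle (dual a)).
have aeta : assignment I eta.
  move=> a Ia; rewrite /eta dualK.
  case: asboolP => [[i Di Ei]|no]; case: asboolP => [[j Dj Ej]|no'] //=.
    by case: (D_em Dj Di Ia Ej).
  have : pickle a != pickle (dual a).
    by rewrite (inj_eq (pcan_inj pickleK)) eq_sym dual_neq.
  by case: ltngtP.
exists eta => // i iN.
have Ei : gl i = loc Gamma i by exact: posn_init.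
rewrite -Ei.
apply: (@exhausted_O_winning I eta D gl Tr) => //.
- by move=> j /D_game[].
- move=> j Dj aj; have [gG lG] := D_game Dj.
  have lj : leaf (gl j) [::] by apply/atomic_leaf.
  rewrite /=; case E: (win (gl j) [::]) => [[]|a] //.
    by case: (D_stop Dj).
  rewrite asboolT; last exact: lG E.
  by rewrite /eta asboolT //; exists j.
- exact: D_init.
- by case=> q [c [c0 Hc]]; exact: D_inf c0 Hc.
Qed.

End Lost.

Lemma run_posn T i c J j : run T i c J -> j < n + T -> posn Gamma f j = loc (H T) j.
Proof. by move=> R jT; apply: posnE => //; exact: run_just R. Qed.

(** This is the state in which DROP applies: every position was passed in the last pass, so none
    admits EM, STOP or a further TRYALL. *)
Lemma lost_finite T J : run T (n + T) (n + T) J -> exists2 eta, assignment I eta &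
  forall i, i < n -> exists S, g_winning (assign I eta (loc Gamma i)) PlayerO S.
Proof.
move=> R; have sz := run_size R; have P := run_passes R erefl.
have E j : j < n + T -> posn Gamma f j = loc (H T) j by exact: run_posn R.
have gT j : j < n + T -> is_game (loc (H T) j) by rewrite -sz; exact: run_games R j.
apply: (@lost_O_winning (fun j => j < n + T) (fun i m j => justifies n f i m j /\ j < n + T)).
- by move=> j jn; lia.
- by move=> j jT; rewrite E //; split; [exact: gT | exact: run_labels R _ _].
- move=> i j a iT jT Ia; rewrite !E // => Ei Ej; have [nE _ _] := P _ iT.
  exact/nE/(em_clause_exists Ia Ei jT Ej).
- by move=> j jT; rewrite E //; case: (P _ jT).
- move=> j m k jT [Hk kT]; split=> //.
  by have [] := posn_justifies (run_just R) kT Hk.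
- move=> j m jT; rewrite E // => tP pm.
  have /hasP[[[a m'] k] Hk /andP[/eqP /= ea /eqP /= em]] := passes_tried (gT _ jT) (P _ jT) tP pm.
  by rewrite ea em in Hk; exists k; exact: run_triples R _ _ _ Hk.
- move=> j m jT; rewrite E // => tO pm.
  have /hasP[[[a m'] k] Hk /eqP /= ea] := passes_has (P _ jT) tO pm.
  rewrite ea in Hk; exists m', k; have [Hj kT] := run_triples R Hk; split=> //.
  have [_ Ek] := posn_justifies (run_just R) kT Hj.
  (* The root of position [k] is the node [[:: m']] of position [j]. *)
  have := pos_nil (gT _ kT); rewrite -E // Ek E //.
(* Indices increase along a chain but stay below [n + T]. *)
- move=> j q c jn c0 Hc; exfalso.
  have lt s : s <= c s.
    elim: s => // s IH; have [Hj kT] := Hc s.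
    have [lt _] := posn_justifies (run_just R) kT Hj; lia.
  by have := lt (n + T).+1; have [_] := Hc (n + T); lia.
Qed.

(** EM is won by P, STOP is played only at the label P, and [Just] is not a leaf. So a leaf not won
    by P is a DROP, made in a state with [i = c = n + T']. *)
Lemma exh_lost_leaf F L i c J s T : exh I L i c J s -> L = H T -> run T i c J ->
  (forall k, k < size s -> f (T.*2 + k) = nth (Drop 0) s k) ->
  ~ (exists m, quant_pos I F L (rcons s m)) -> quant_win L s <> inl PlayerP ->
  exists T' J', run T' (n + T') (n + T') J'.
Proof.
move=> Hx; elim: Hx T => {L i c J s}
  [L c J u cL Hx IH|L J u Hu|L i c J j u ic Ej Hu|L i c J u ic Pi Hu
  |L i c J u ic nE nP ai Hx IH|L i c J m u ic ni mi Hu|L i c J m u ic ni mi Hx IH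
  |L i c J u ic ni nm Hx IH] T EL R fs nl nw; have sz := run_size R; rewrite -EL in sz.
- by apply: (IH T EL _ fs nl nw); rewrite sz; apply: (run_repeat R); rewrite -sz.
- by exists T, J; rewrite -sz.
- by case: Hu nw nl => -> //= _ []; exists (Drop (size L)).
- case: Hu nw nl => -> //= nw nl; first by case: nl; exists (Drop (size L)).
  by case: nw; case: Pi.
- apply: (IH T EL _ fs nl nw); apply: run_next => //; rewrite -EL; split=> //; by left.
- case: Hu nl => -> //= nl; case: nl; first by exists (Drop (size L)).
  have iL : i < size L by rewrite sz; have := run_c R; lia.
  have gL : games L by rewrite EL; exact: run_games R.
  by exists m; split; [split | split=> //; exact: try_move_pos (gL _ iL) mi].
- have iL : i < size L by rewrite sz; have := run_c R; lia.
  have f0 : f T.*2 = Just i (n + T) by have := fs 0 isT; rewrite addn0 sz.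
  have f1 : f T.*2.+1 = m by have := fs 1 isT; rewrite addn1.
  apply: (IH T.+1) => //.
  + by rewrite /= f0 f1 EL.
  + by rewrite -f1 sz; apply: run_try => //; rewrite -EL f1.
  + by move=> k ks; have := fs k.+2 ks; rewrite -[RHS]/(nth (Drop 0) u k) => <-; congr f; lia.
  + case=> m' pm'; apply: nl; exists m'; split; first by split.
    split=> //; apply: try_move_pos mi; have gL : games L by rewrite EL; exact: run_games R.
    exact: gL.
- apply: (IH T EL _ fs nl nw); apply: run_next => //; rewrite -EL; exact: nonatomic_passes.
Qed.

(** * Infinite plays: fairness of EXH *)

Section Infinite.
(** The prefixes have length [r.+2], so each contains a full round and [exh_inv2] always applies. *)
Definition live T i c J := run T i c J /\
  forall r, exh I (H T) i c J (mkseq (fun x => f (T.*2 + x)) r.+2).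

Lemma live_step T i c J : live T i c J ->
  [\/ [/\ i = c, c < n + T & live T 0 (n + T) J],
      [/\ i < c, passes (H T) i c J & live T i.+1 c J]
    | [/\ i < c, ~ atomic (loc (H T) i), try_move (H T) J i (f T.*2.+1),
         f T.*2 = Just i (n + T) & live T.+1 i.+1 c (rcons J (i, f T.*2.+1, n + T))]].
Proof.
move=> [R Hx]; have sz := run_size R.
have E r : mkseq (fun x => f (T.*2 + x)) r.+2 =
   [:: f T.*2, f T.*2.+1 & mkseq (fun x => f (T.+1.*2 + x)) r].
  by rewrite !mkseqSl /= addn0 addn1 shift_double.
have inv r : exh I (H T) i c J [:: f T.*2, f T.*2.+1 & mkseq (fun x => f (T.+1.*2 + x)) r].
  by rewrite -E.
(* A priori each prefix could come from another clause. The clause found for the shortest one is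
   used for all, because the clauses exclude each other. *)
have [[ic cT _]|[ic pi _]|[ic ni fT tm _]] := exh_inv2 (inv 0).
- constructor 1; rewrite sz in cT; split=> //; split; first by rewrite ic in R; exact: run_repeat R cT.
  by move=> r; rewrite E -sz; have [[_ _ ?]|[? _ _]|[? _ _ _ _]] := exh_inv2 (inv r); [|lia|lia].
- constructor 2; split=> //; split; first exact: run_next.
  move=> r; rewrite E; have [[? _ _]|[_ _ ?]|[? na _ tm _]] := exh_inv2 (inv r); [lia|by []|].
  by case: pi => _ _ [|[]] //; exists (f T.*2.+1).
- rewrite sz in fT; constructor 3; split=> //; split; first exact: run_try.
  move=> r; have [[? _ _]|[? pi _]|[? _ _ _]] := exh_inv2 (inv r.+2); first lia.
    by case: pi => _ _ [|[]] //; exists (f T.*2.+1).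
  by rewrite sz /= fT.
Qed.

Lemma live_sub T i c J i' : live T i c J -> i <= i' <= c ->
  exists T' J', [/\ live T' i' c J', T <= T' & {subset J <= J'}].
Proof.
move=> Lv /andP[ii' i'c]; move Ek: (i' - i) => k.
elim: k T i J Lv ii' Ek => [|k IH] T i J Lv ii' Ek.
  have E : i = i' by lia.
  by exists T, J; rewrite -E; split.
have [[]|[ic _ Lv']|[ic _ _ _ Lv']] := live_step Lv; first lia.
  by have [||T' [J' [l TT JJ]]] := IH _ _ _ Lv'; try lia; exists T', J'.
have [||T' [J' [l TT JJ]]] := IH _ _ _ Lv'; try lia; exists T', J'; split=> //; first lia.
by move=> t tJ; apply: JJ; rewrite mem_rcons inE tJ orbT.
Qed.

(** An infinite play cannot finish a pass by DROP, so REPEAT follows and strictly raises the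
    bound. *)
Lemma live_repeat T i c J : live T i c J ->
  exists T' J', [/\ live T' 0 (n + T') J', T <= T', c < n + T' & {subset J <= J'}].
Proof.
move=> Lv; have ic := run_ic (proj1 Lv).
have [T' [J' [Lv' TT JJ]]] : exists T' J', [/\ live T' c c J', T <= T' & {subset J <= J'}].
  by apply: live_sub Lv _; rewrite ic leqnn.
by have [[_ cT Lv'']|[]|[]] := live_step Lv'; [exists T', J' | lia | lia].
Qed.

Lemma live_large T i c J N : live T i c J ->
  exists T' J', [/\ live T' 0 (n + T') J', T <= T', N < n + T' & {subset J <= J'}].
Proof.
move=> Lv; elim: N => [|N [T' [J' [Lv' TT NT JJ]]]].
  have [T' [J' [Lv' TT cT JJ]]] := live_repeat Lv; exists T', J'; split=> //; lia.
have [T'' [J'' [Lv'' TT' cT JJ']]] := live_repeat Lv'.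
exists T'', J''; split=> //; [lia | lia |].
by move=> t /JJ /JJ'.
Qed.

(** Fairness: after any state, position [j] is treated at some state, with [c] as large as wanted.
    The latter brings a dual label at a later index within reach of EM. *)
Lemma live_visit T i c J N j : live T i c J -> exists T' J' c',
  [/\ live T' j c' J', N < c', j < c', T <= T' & {subset J <= J'}].
Proof.
move=> Lv; have [T' [J' [Lv' TT NT JJ]]] := live_large (maxn N j) Lv.
have [|T'' [J'' [Lv'' TT' JJ']]] := live_sub (i' := j) Lv'; first lia.
by exists T'', J'', (n + T'); split=> //; try lia; move=> t /JJ /JJ'.
Qed.

Hypothesis f_exh : forall r, EXH I Gamma (mkseq f r).
Hypothesis f_lost : ~ P_thread Gamma f.

Lemma live0 : live 0 0 n [::].
Proof. by split; [exact: run0 | move=> r; exact: f_exh]. Qed.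

Lemma justified_all T : justified n f T.
Proof.
have [T' [J' [[R _] _ TT _]]] := live_large (n + T) live0.
apply: justifiedW (run_just R); lia.
Qed.

Let gl := posn Gamma f.

Lemma live_posn T i c J j : live T i c J -> j < c -> gl j = loc (H T) j.
Proof. by move=> [R _] jc; apply: (run_posn R); have := run_c R; lia. Qed.

(** By strong induction on the place [k] in the enumeration: once all earlier moves are tried, the
    next visit of [j] takes move [k] unless it is tried already. *)
Lemma live_tried j k m T i c J : live T i c J -> turn (gl j) [::] = PlayerP ->
  children (gl j) [::] k = Some m ->
  exists T' i' c' J', [/\ live T' i' c' J', {subset J <= J'} & tried J' j m].
Proof.
move=> + tP; elim/ltn_ind: k m T i c J => k IH m T i c J Lv Ek.
(* Triples are never removed, so the finitely many earlier moves are all tried in one later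
   state. *)
have [T' [i' [c' [J' [Lv' JJ H']]]]] : exists T' i' c' J',
    [/\ live T' i' c' J', {subset J <= J'} & forall k' m', k' < k -> children (gl j) [::] k' = Some m' -> tried J' j m'].
  have : k <= k by []. move: {-2}k => l; elim: l => [|l IHl] lk.
    by exists T, i, c, J; split.
  have [T' [i' [c' [J' [Lv' JJ H']]]]] := IHl (ltnW lk).
  case El : (children (gl j) [::] l) => [m0|]; last first.
    exists T', i', c', J'; split=> // k' m'; rewrite ltnS leq_eqVlt => /orP[/eqP ->|]; last exact: H'.
    by rewrite El.
  have [T2 [i2 [c2 [J2 [Lv2 JJ2 tr2]]]]] := IH l lk m0 _ _ _ _ Lv' El.
  exists T2, i2, c2, J2; split=> //; first by move=> t /JJ /JJ2.
  move=> k' m'; rewrite ltnS leq_eqVlt => /orP[/eqP ->|kl].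
    by rewrite El => -[<-].
  by move=> /(H' _ _ kl); rewrite /tried => /hasP[t /JJ2 tJ e]; apply/hasP; exists t.
have [T2 [J2 [c2 [Lv2 _ jc _ JJ2]]]] := live_visit 0 j Lv'.
have Ej := live_posn Lv2 jc.
have jT : j < size (H T2) by rewrite (run_size (proj1 Lv2)); have := run_c (proj1 Lv2); lia.
have gG := run_games (proj1 Lv2) jT.
have pm : pos (loc (H T2) j) [:: m].
  by have [_ /(_ [::])[E _ _] _ _] := gG; apply/E; exists k; rewrite -Ej.
have [[? _]|[_ pj Lv3]|[_ nj tm fT Lv3]] := live_step Lv2; first lia.
  exists T2, j.+1, c2, J2; split=> //; first by move=> t /JJ /JJ2.
  by apply: passes_tried gG pj _ pm; rewrite -Ej.
have [tr|ntr] := boolP (tried J2 j m).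
  by exists T2, j, c2, J2; split=> //; move=> t /JJ /JJ2.
exists T2.+1, j.+1, c2, (rcons J2 (j, f T2.*2.+1, n + T2)); split=> //.
  by move=> t /JJ /JJ2 tJ; rewrite mem_rcons inE tJ orbT.
move: tm; rewrite /try_move -Ej tP => -[l [El ntl Hl]].
(* TRYALL takes the least untried index [l]. It is not below [k], where all moves are tried, nor
   above, since move [k] is untried. *)
suff -> : m = f T2.*2.+1 by rewrite /tried has_rcons /= !eqxx.
have [ll|ll|ll] := ltngtP l k.
- case/negP: ntl; have := H' _ _ ll El; rewrite /tried => /hasP[t /JJ2 tJ e].
  by apply/hasP; exists t.
- by case/negP: ntr; exact: Hl Ek.
- by move: El; rewrite ll Ek => -[].
Qed.

Lemma lost_infinite : exists2 eta, assignment I eta &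
  forall i, i < n -> exists S, g_winning (assign I eta (loc Gamma i)) PlayerO S.
Proof.
have visit j N : exists T J c, [/\ live T j c J, N < c, j < c, gl j = loc (H T) j & j < n + T].
  have [T [J [c [Lv Nc jc _ _]]]] := live_visit N j live0.
  exists T, J, c; split=> //; first exact: live_posn Lv _.
  by have := run_c (proj1 Lv); lia.
have gG j : is_game (gl j).
  have [T [J [c [[R _] _ jc -> jT]]]] := visit j 0.
  by apply: (run_games R); rewrite (run_size R).
have Tr_gl j m k : justifies n f j m k -> gl k = subgame (gl j) [:: m].
  move=> Hk; have kT : k < n + k.+1 by lia.
  by have [] := posn_justifies (@justified_all _) kT Hk.
apply: (@lost_O_winning (fun=> True) (justifies n f)) => //.
- move=> j _; split; first exact: gG.
  have [T [J [c [[R _] _ jc Ej jT]]]] := visit j 0.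
  by have := run_labels R jT; rewrite -Ej.
- move=> i j a _ _ Ia Ei Ej.
  (* At a visit of [i] with [j < c] the EM clause would apply and end the play. *)
  have [T [J [c [Lv jc ic Ei' iT]]]] := visit i j.
  have Ej' := live_posn Lv jc; rewrite -/gl Ei' in Ei; rewrite -/gl Ej' in Ej.
  have [[? _]|[_ [nE _ _] _]|[_ na _]] := live_step Lv; first lia.
    by apply: nE; exact: em_clause_exists Ia Ei jc Ej.
  by case: na; case: Ei.
- move=> j _ Ej; have [T [J [c [Lv _ jc Ej' _]]]] := visit j 0.
  rewrite -/gl Ej' in Ej.
  have [[? _]|[_ [_ nP _] _]|[_ na _]] := live_step Lv; first lia.
    exact: nP.
  by case: na; case: Ej.
- by move=> j m k _ Hk; split=> //; exact: Tr_gl.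
- move=> j m _ tP pm.
  have [_ /(_ [::])[E _ _] _ _] := gG j; have /E[k Ek] := pm.
  have [T [i [c [J [[R _] _]]]]] := live_tried live0 tP Ek.
  move=> /hasP[[[a m'] l] Hl /andP[/eqP /= ea /eqP /= em]].
  by rewrite ea em in Hl; exists l; case: (run_triples R Hl).
- move=> j m _ tO pm.
  (* A visit of [j] either finds a triple of [j] in the list or makes such a move itself. *)
  have [m' [k Hk]] : exists m' k, justifies n f j m' k.
    have [T [J [c [Lv _ jc Ej _]]]] := visit j 0.
    have [[? _]|[_ pj [R _]]|[_ na _ fT _]] := live_step Lv; first lia.
      rewrite -/gl Ej in tO pm; have /hasP[[[a m'] k] Hk /eqP /= ea] := passes_has pj tO pm.
      by rewrite ea in Hk; exists m', k; case: (run_triples R Hk).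
    by exists (f T.*2.+1), (n + T), T.
  exists m', k; split=> //; have := pos_nil (gG k).
  by rewrite (Tr_gl _ _ _ Hk).
- move=> j q c jn c0 Hc qP; apply: f_lost; exists j, q; split=> //.
    exists c; split=> // s; have kT : c s.+1 < n + (c s.+1).+1 by lia.
    by have [] := posn_justifies (@justified_all _) kT (Hc s).
  by rewrite -(posn_init f jn).
Qed.

End Infinite.
End Play.

Lemma EXH_winning_or_lost Gamma : games Gamma ->
  (forall j, j < size Gamma -> labels_in (loc Gamma j)) ->
  g_winning (quant I Gamma) PlayerP (EXH I Gamma) \/
  exists2 eta, assignment I eta & forall i, i < size Gamma ->
    exists S, g_winning (assign I eta (loc Gamma i)) PlayerO S.
Proof.
move=> gG lG.
have [?|nlost] := pselect (exists2 eta, assignment I eta & forall i, i < size Gamma ->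
    exists S, g_winning (assign I eta (loc Gamma i)) PlayerO S); [by right | left].
have EP F s : EXH I Gamma s -> quant_pos I F Gamma s by exact: exh_pos.
split; first split; first split; first split; first split.
- by split=> [|s t]; [exact: exh_nil | exact: exh_pre].
- by move=> s; exact: EP.
- by move=> p Sp _ t m pm; exact: exh_cl Sp t pm.
- by move=> p Sp [_ nl] t; exact: exh_total Sp nl t.
- move=> p Sp [pp nl]; apply: contrapT => nw; apply: nlost.
  (* The finite play is padded with [Drop 0] to a function on all numbers. *)
  have [T [J R]] := exh_lost_leaf (T := 0) Sp erefl (run0 (nth (Drop 0) p) gG lG)
    (fun k _ => erefl) nl nw.
  exact: lost_finite R.
move=> f Hf; split; first by move=> k; apply: EP; exact: Hf.
by apply: contrapT => nP; apply: nlost; exact: lost_infinite Hf nP.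
Qed.

End Exh.

(** P walks to the leaf by always justifying the next move with the newest position, then stops
    there. *)
Lemma leaf_in_quant I F L i p a : games L -> i < size L -> leaf (loc L i) p ->
  win (loc L i) p = inr a -> F a ->
  exists r, [/\ quant_pos I F L r, ~ (exists m, quant_pos I F L (rcons r m))
              & quant_win L r = inr a].
Proof.
move=> gL iL lp wp Fa; elim: p L i gL iL lp wp => [|m p IH] L i gL iL lp wp.
  exists [:: Stop i]; split=> //=; last by case=> m [].
  by split=> //; right; exists a => //; split=> //; apply/atomic_leaf => //; exact: gL.
have pm : pos (loc L i) [:: m] by case: lp => /(@pos_pre _ [:: m] p (gL _ iL)).
have [||||r [pr nr wr]] := IH (extend L i m) (size L).
- exact: games_extend.
- by rewrite size_extend.
- by rewrite loc_extend_size.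
- by rewrite loc_extend_size.
exists [:: Just i (size L), m & r]; split=> //=.
- by split; [split=> //; exact: nonatomic_pos pm | split].
- by case=> m' [_ [_ H]]; apply: nr; exists m'.
Qed.

Lemma FV_quant_empty I L : selfdual I -> games L -> FV (quant I L) = set0 ->
  (forall j, j < size L -> labels_in I (loc L j)) /\ FVs L `\` I = set0.
Proof.
move=> Idual gL FV0.
have H j : j < size L -> labels_in I (loc L j).
  move=> jL p a lp wp; apply: contrapT => nIa.
  have Fa : (FVs L `\` I) a.
    by split=> //; exists j => // X [_]; apply; exists p.
  have [r [pr nr wr]] := leaf_in_quant I gL jL lp wp Fa.
  rewrite -[False]/(set0 a) -FV0 => X [_]; apply; exists r => //.
(* [I] is self-dual and contains all labels of [loc L j], so it contains the least such set. *)
split=> //; apply/seteqP; split=> // a [[j jL Ha] nIa]; case: nIa; apply: Ha; split=> //.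
by move=> b [p lp wp]; exact: (H _ jL _ _ lp wp).
Qed.

End Games.

(** * EXH as a primitive recursive decision procedure *)

(** [coded] vanishes off the codes, so the set of codes of plays has to be decided primitive
    recursively. *)
Lemma prim_rec_coded orc (U : countType) (f : seq gmove -> U) :
  primrec orc f -> prim_rec orc (fun v : 1.-tuple nat => coded f (thead v)).
Proof.
move=> [F pF HF].
(* Mirrors the patterns of [gmove_decode]: the constructors 0, 2, 4 take one argument, 1 and 3 take
   two. *)
pose chk (s : seq nat) := let k := nth 0 s 0 in
  (size s == 2) && [|| k == 0, k == 2 | k == 4] || (size s == 3) && ((k == 1) || (k == 3)).
have chkP s : chk s = isSome (gmove_decode s).
  by rewrite /chk; case: s => [|k [|y [|z [|w s]]]] //=; case: k => [|[|[|[|[|k]]]]].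
have Dk x : pickle (CodeSeq.decode x) = x.
  by rewrite -[LHS]/(CodeSeq.code (map id _)) map_id CodeSeq.decodeK.
pose valid (x : nat) := ~~ has (fun y => ~~ chk (CodeSeq.decode y)) (CodeSeq.decode x).
have pvalid : primrec orc valid.
  apply: pr_not; apply: pr_has.
    by apply: (@pr_code _ _ nat _ (fun x => x)); [move=> x; exact: Dk|exact: pr_var].
  apply: pr_not.
  apply: (@pr_compose _ (nat * nat)%type (seq nat) _ chk (fun u => CodeSeq.decode u.2)); last first.
    apply: (@pr_code _ _ nat _ (fun x => x.2)); last by apply: pr_snd; exact: pr_var.
    by case=> x y; exact: Dk.
  have pn : primrec orc (fun s : seq nat => nth 0 s 0).
    by apply: pr_nth; [exact: pr_var|exact: pr_const].
  have ps : primrec orc (fun s : seq nat => size s) by apply: pr_size; exact: pr_var.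
  by apply: pr_or; apply: pr_and; do ?[apply: pr_or]; apply: pr_eq => //; exact: pr_const.
have [V pV HV] := pvalid.
have vP x : valid x <-> exists t : seq gmove, pickle t = x.
  split; last first.
    case=> t <-; rewrite /valid -[pickle t]/(CodeSeq.code (map pickle t)) CodeSeq.codeK -all_predC all_map.
    apply/allP => m _ /=; have -> : pickle m = CodeSeq.code (gmove_code m) by case: m.
    by rewrite CodeSeq.codeK negbK chkP gmove_codeK.
  rewrite /valid -all_predC -{2}(CodeSeq.decodeK x); elim: (CodeSeq.decode x) => [|y s IH] /=.
    by exists [::].
  rewrite negbK chkP => /andP[cy /IH[t Et]].
  case E: (gmove_decode (CodeSeq.decode y)) cy => [m|] // _; exists (m :: t).
  rewrite -Et -[LHS]/(2 ^ pickle m * (pickle t).*2.+1).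
  suff -> : pickle m = y by [].
  have -> : pickle m = CodeSeq.code (gmove_code m) by case: m {E}.
  have -> : gmove_code m = CodeSeq.decode y.
    by case: (CodeSeq.decode y) E => [|[|[|[|[|[|?]]]]] [|? [|? [|? ?]]]] //= [<-].
  exact: CodeSeq.decodeK.
apply: (@eq_prim_rec _ _ (fun v => if V (thead v) != 0 then F (thead v) else 0)); last first.
  by apply: prim_rec_if => //; exact: pr_zero.
move=> v; have -> : V (thead v) = valid (thead v) by exact: HV.
rewrite eqb0 negbK /coded.
case: ifP => [/vP[t <-]|nv]; first by rewrite pickleK_inv HF.
case E: (pickle_inv _) => [t|] //; have := pickle_invK (thead v) (T := seq gmove).
rewrite E /= => H; have : valid (thead v) by apply/vP; exists t.
by rewrite nv.
Qed.

Section Simulation.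
Variables (A : params) (I : set A) (Gamma : seq (game A)).
Hypotheses (gG : games Gamma) (lG : forall j, j < size Gamma -> labels_in I (loc Gamma j)).
Let n := size Gamma.
Local Notation orc := (oracles Gamma).

(* (i, x) stands for the local position (G_i)_x. *)
Local Notation lpos := (nat * seq gmove)%type.
Definition lgame (u : lpos) : game A := subgame (loc Gamma u.1) u.2.

(** Queries to the oracles at a node. The guard [u.1 < n] gives them the shape required by
    [pr_below]. *)
Definition opos (u : lpos) : bool := if u.1 < n then `[< pos (loc Gamma u.1) u.2 >] else false.
Definition ochild (u : lpos) k : option gmove :=
  if u.1 < n then children (loc Gamma u.1) u.2 k else None.
Definition oturn (u : lpos) : option player :=
  if u.1 < n then
    if `[< nonleaf (loc Gamma u.1) u.2 >] then Some (turn (loc Gamma u.1) u.2) else None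
  else None.
Definition owin (u : lpos) : option (player + A)%type :=
  if u.1 < n then
    if `[< leaf (loc Gamma u.1) u.2 >] then Some (win (loc Gamma u.1) u.2 : (player + A)%type)
    else None
  else None.

(* A state of the computation of EXH together with the rest of the play. *)
Local Notation conf := ((seq lpos * (nat * nat)) * (seq (nat * gmove * nat) * seq gmove))%type.

Implicit Types (x y : conf).
Definition cps x := x.1.1.
Definition ci x := x.1.2.1.
Definition cc x := x.1.2.2.
Definition cJ x := x.2.1.
Definition cs x := x.2.2.
Definition cu x : lpos := nth (0, [::]) (cps x) (ci x).
Definition cm x : gmove := nth (Drop 0) (cs x) 1.

Local Notation result := (option bool * conf)%type.

Definition one (s : seq gmove) m := (s == [::]) || (s == [:: m]).
Definition verdict b x : result := (Some b, x).
Definition next x : result := (None, ((cps x, ((ci x).+1, cc x)), x.2)).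
Definition emidx x (a : A) :=
  find (fun j => owin (nth (0, [::]) (cps x) j) == Some (inr (dual a))) (iota 0 (cc x)).
Definition leaf_step x (l : (player + A)%type) : result :=
  match l with
  | inl g => if g == PlayerP then verdict (one (cs x) (Stop (ci x))) x else next x
  | inr a => if emidx x a < cc x then verdict (one (cs x) (Em (ci x) (emidx x a))) x else next x
  end.
(** The range [size J + 1] suffices by the pigeonhole principle; the end of the enumeration also
    stops the search. *)
Definition untried x :=
  find (fun k => if ochild (cu x) k is Some m then ~~ tried (cJ x) (ci x) m else true)
    (iota 0 (size (cJ x)).+1).
(** The play supplies the candidate move [cm x], so even a union over infinitely many moves is
    tested at a single one; [b] is the outcome of that test. *)
Definition try_step x (b : bool) : result :=
  if one (cs x) (Just (ci x) (size (cps x))) then verdict true x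
  else if [&& nth (Drop 0) (cs x) 0 == Just (ci x) (size (cps x)), 1 < size (cs x) & b] then
    (None, ((rcons (cps x) ((cu x).1, rcons (cu x).2 (cm x)), ((ci x).+1, cc x)),
            (rcons (cJ x) (ci x, cm x, size (cps x)), drop 2 (cs x))))
  else verdict false x.
Definition nonleaf_step x : result :=
  if oturn (cu x) == Some PlayerP then
    if ochild (cu x) (untried x) is Some m then try_step x (cm x == m) else next x
  else if has (fun t : triple => t.1.1 == ci x) (cJ x) then next x
  else try_step x (opos ((cu x).1, rcons (cu x).2 (cm x))).
Definition step x : result :=
  if ci x == cc x then
    if cc x < size (cps x) then (None, ((cps x, (0, size (cps x))), x.2))
    else verdict (one (cs x) (Drop (size (cps x)))) x
  else if owin (cu x) is Some l then leaf_step x l else nonleaf_step x.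
Definition run_step (r : result) : result := if r.1 is Some _ then r else step r.2.
(** Exceeds the [measure] of the initial state for [N = n + size s], which bounds the number of
    local positions of the play. *)
Definition fuel (s : seq gmove) := size s * (n + size s + (n + size s) + 4) + (n + n + 2).
Definition init (s : seq gmove) : result :=
  (None, (([seq (i, [::]) | i <- iota 0 n], (0, n)), ([::], s))).
Definition simulate s := (iter (fuel s) run_step (init s)).1 == Some true.

(** * The step function is primitive recursive *)

Section Pr.
Implicit Types T : countType.
Local Notation pr := (primrec orc).

Lemma pr_oracle_opos T (a : T -> lpos) : pr a -> pr (fun t => opos (a t)).
Proof.
move=> pa; rewrite /opos.
apply: (@pr_below _ _ _ n (fun i t => `[< pos (loc Gamma i) (a t).2 >]) false (fun t => (a t).1)).
  exact: pr_fst.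
move=> k kn; apply: (@pr_compose _ _ _ _ (fun p => `[< pos (loc Gamma k) p >])); last exact: pr_snd.
by apply: pr_coded; right; exists k => //; left; left; left.
Qed.

Lemma pr_oracle_ochild T (a : T -> lpos) (b : T -> nat) :
  pr a -> pr b -> pr (fun t => ochild (a t) (b t)).
Proof.
move=> pa pb; rewrite /ochild.
apply: (@pr_below _ _ _ n (fun i t => children (loc Gamma i) (a t).2 (b t)) None (fun t => (a t).1)).
  exact: pr_fst.
move=> k kn; apply: (@pr_compose _ _ _ _ (fun pk => children (loc Gamma k) pk.1 pk.2)
   (fun t => ((a t).2, b t))).
  by apply: pr_coded; right; exists k => //; left; left; right.
by apply: pr_pair => //; exact: pr_snd.
Qed.

Lemma pr_oracle_oturn T (a : T -> lpos) : pr a -> pr (fun t => oturn (a t)).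
Proof.
move=> pa; rewrite /oturn.
apply: (@pr_below _ _ _ n (fun i t => if `[< nonleaf (loc Gamma i) (a t).2 >]
   then Some (turn (loc Gamma i) (a t).2) else None) None (fun t => (a t).1)).
  exact: pr_fst.
move=> k kn; apply: (@pr_compose _ _ _ _ (fun p => if `[< nonleaf (loc Gamma k) p >]
   then Some (turn (loc Gamma k) p) else None)); last exact: pr_snd.
by apply: pr_coded; right; exists k => //; left; right.
Qed.

Lemma pr_oracle_owin T (a : T -> lpos) : pr a -> pr (fun t => owin (a t)).
Proof.
move=> pa; rewrite /owin.
apply: (@pr_below _ _ _ n (fun i t => if `[< leaf (loc Gamma i) (a t).2 >]
   then Some (win (loc Gamma i) (a t).2 : (player + A)%type) else None) None (fun t => (a t).1)).
  exact: pr_fst.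
move=> k kn; apply: (@pr_compose _ _ _ _ (fun p => if `[< leaf (loc Gamma k) p >]
   then Some (win (loc Gamma k) p : (player + A)%type) else None)); last exact: pr_snd.
by apply: pr_coded; right; exists k => //; right.
Qed.

Lemma pr_dual T (a : T -> A) : pr a -> pr (fun t => dual (a t)).
Proof. by apply: pr_compose; apply: pr_coded; left. Qed.

Ltac prs1 :=
  lazymatch goal with
  | |- primrec _ (fun t => t) => exact: pr_var
  | |- primrec _ fst => exact: (pr_fst (pr_var _ _))
  | |- primrec _ snd => exact: (pr_snd (pr_var _ _))
  | |- primrec _ (fun t => (@?a t).1) => apply: (@pr_fst _ _ _ _ a)
  | |- primrec _ (fun t => (@?a t).2) => apply: (@pr_snd _ _ _ _ a)
  | |- primrec _ (fun t => (@?a t, @?b t)) => apply: (@pr_pair _ _ _ _ a b)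
  | |- primrec _ (fun t => opos (@?a t)) => apply: (@pr_oracle_opos _ a)
  | |- primrec _ (fun t => ochild (@?a t) (@?b t)) => apply: (@pr_oracle_ochild _ a b)
  | |- primrec _ (fun t => oturn (@?a t)) => apply: (@pr_oracle_oturn _ a)
  | |- primrec _ (fun t => owin (@?a t)) => apply: (@pr_oracle_owin _ a)
  | |- primrec _ (fun t => dual (@?a t)) => apply: (@pr_dual _ a)
  | |- primrec _ (fun t => Some (@?a t)) => apply: (@pr_some _ _ _ a)
  | |- primrec _ (fun t => inr (@?a t)) => apply: (@pr_inr _ _ _ _ a)
  | |- primrec _ (fun t => Just (@?a t) (@?b t)) => apply: (@pr_Just _ _ a b)
  | |- primrec _ (fun t => Em (@?a t) (@?b t)) => apply: (@pr_Em _ _ a b)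
  | |- primrec _ (fun t => Stop (@?a t)) => apply: (@pr_Stop _ _ a)
  | |- primrec _ (fun t => Drop (@?a t)) => apply: (@pr_Drop _ _ a)
  | |- primrec _ (fun t => rcons (@?a t) (@?b t)) => apply: (@pr_rcons _ _ _ a b)
  | |- primrec _ (fun t => (@?a t) :: (@?b t)) => apply: (@pr_cons _ _ _ a b)
  | |- primrec _ (fun t => drop (@?a t) (@?b t)) => apply: (@pr_drop _ _ _ a b)
  | |- primrec _ (fun t => nth ?x (@?a t) (@?b t)) => apply: (@pr_nth _ _ _ x a b)
  | |- primrec _ (fun t => size (@?a t)) => apply: (@pr_size _ _ _ a)
  | |- primrec _ (fun t => (@?a t) + (@?b t)) => apply: (@pr_add _ _ a b)
  | |- primrec _ (fun t => (@?a t) * (@?b t)) => apply: (@pr_mul _ _ a b)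
  | |- primrec _ (fun t => (@?a t) < (@?b t)) => apply: (@pr_ltn _ _ a b)
  | |- primrec _ (fun t => (@?a t).+1) => apply: (@pr_S _ _ a)
  | |- primrec _ (fun t => (@?a t) || (@?b t)) => apply: (@pr_or _ _ a b)
  | |- primrec _ (fun t => (@?a t) && (@?b t)) => apply: (@pr_and _ _ a b)
  | |- primrec _ (fun t => (@?a t) == (@?b t)) => apply: (@pr_eq _ _ _ a b)
  | |- primrec _ (fun t => ~~ (@?a t)) => apply: (@pr_not _ _ a)
  end.
Ltac prs := rewrite /cm /cu /cs /cJ /cc /ci /cps; repeat first [assumption | exact: pr_const | prs1].

Lemma pr_one T (a : T -> seq gmove) (m : T -> gmove) : pr a -> pr m -> pr (fun t => one (a t) (m t)).
Proof. by move=> pa pm; rewrite /one; prs. Qed.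

Lemma pr_verdict T (b : T -> bool) (a : T -> conf) :
  pr a -> pr b -> pr (fun t => verdict (b t) (a t)).
Proof. by move=> pa pb; rewrite /verdict; prs. Qed.

Lemma pr_next T (a : T -> conf) : pr a -> pr (fun t => next (a t)).
Proof. by move=> pa; rewrite /next; prs. Qed.

Lemma pr_tried T (J : T -> seq (nat * gmove * nat)) (i : T -> nat) (m : T -> gmove) :
  pr J -> pr i -> pr m -> pr (fun t => tried (J t) (i t) (m t)).
Proof.
move=> pJ pi pm; rewrite /tried; apply: pr_has => //; prs.
- by apply: (pr_compose pi); prs.
- by apply: (pr_compose pm); prs.
Qed.

Lemma pr_emidx T (a : T -> conf) (b : T -> A) : pr a -> pr b -> pr (fun t => emidx (a t) (b t)).
Proof.
move=> pa pb; rewrite /emidx; apply: pr_find; first by prs.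
by prs; [apply: (pr_compose pa) | apply: (pr_compose pb)]; prs.
Qed.

Lemma pr_leaf_step T (a : T -> conf) (l : T -> (player + A)%type) :
  pr a -> pr l -> pr (fun t => leaf_step (a t) (l t)).
Proof.
move=> pa pl; rewrite /leaf_step; apply: pr_sum_case => //.
  have pa' : pr (fun u : T * player => a u.1) by apply: (pr_compose pa); prs.
  apply: pr_if; [by prs | | exact: pr_next].
  by apply: pr_verdict => //; apply: pr_one; prs.
have pa' : pr (fun u : T * A => a u.1) by apply: (pr_compose pa); prs.
have pe : pr (fun u : T * A => emidx (a u.1) u.2) by apply: pr_emidx => //; prs.
apply: pr_if; [by prs | | exact: pr_next].
by apply: pr_verdict => //; apply: pr_one; prs.
Qed.

Lemma pr_untried T (a : T -> conf) : pr a -> pr (fun t => untried (a t)).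
Proof.
move=> pa; rewrite /untried; apply: pr_find; first by prs.
have pa' : pr (fun u : T * nat => a u.1) by apply: (pr_compose pa); prs.
apply: (@pr_option_case _ _ _ _ (fun u : T * nat => ochild (cu (a u.1)) u.2) (fun=> true)
  (fun u m => ~~ tried (cJ (a u.1)) (ci (a u.1)) m)); [by prs | by prs |].
have pa2 : pr (fun u : T * nat * gmove => a u.1.1) by apply: (pr_compose pa); prs.
by apply: pr_not; apply: pr_tried; prs.
Qed.

Lemma pr_try_step T (a : T -> conf) (b : T -> bool) :
  pr a -> pr b -> pr (fun t => try_step (a t) (b t)).
Proof.
move=> pa pb; rewrite /try_step; apply: pr_if; first by apply: pr_one; prs.
  by apply: pr_verdict; prs.
apply: pr_if; [by prs | by prs |].
by apply: pr_verdict; prs.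
Qed.

Lemma pr_nonleaf_step T (a : T -> conf) : pr a -> pr (fun t => nonleaf_step (a t)).
Proof.
move=> pa; rewrite /nonleaf_step; apply: pr_if; first by prs.
  have pu := pr_untried pa.
  apply: (@pr_option_case _ _ _ _ (fun t => ochild (cu (a t)) (untried (a t)))
    (fun t => next (a t)) (fun t m => try_step (a t) (cm (a t) == m))).
  - by prs.
  - exact: pr_next.
  - have pa' : pr (fun u : T * gmove => a u.1) by apply: (pr_compose pa); prs.
    by apply: pr_try_step; prs.
apply: pr_if; last by apply: pr_try_step; prs.
  apply: pr_has; first by prs.
  have pa' : pr (fun u : T * (nat * gmove * nat) => a u.1) by apply: (pr_compose pa); prs.
  by prs.
exact: pr_next.
Qed.

Lemma pr_step : pr step.
Proof.
have pv : pr (fun x : conf => x) by exact: pr_var.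
rewrite /step; apply: pr_if; first by prs.
  apply: pr_if; [by prs | by prs |].
  by apply: pr_verdict => //; apply: pr_one; prs.
apply: (@pr_option_case _ _ _ _ (fun x : conf => owin (cu x)) nonleaf_step leaf_step).
- by prs.
- exact: pr_nonleaf_step.
- by apply: pr_leaf_step; prs.
Qed.

Lemma pr_simulate : pr simulate.
Proof.
rewrite /simulate; apply: pr_eq; last exact: pr_const.
apply: pr_fst; apply: pr_iter.
- by rewrite /fuel; prs.
- by rewrite /init; prs.
- apply: (@pr_option_case _ _ _ _ (fun u : seq gmove * result => u.2.1)
    (fun u => step u.2.2) (fun u _ => u.2)); [by prs | | by prs].
  by apply: (pr_compose pr_step); prs.
Qed.

End Pr.

(** * Correctness and termination of the simulation *)

Definition clocs x : seq (game A) := map lgame (cps x).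
Definition accepted x := exh I (clocs x) (ci x) (cc x) (cJ x) (cs x).

Definition lvalid (u : lpos) := u.1 < n /\ pos (loc Gamma u.1) u.2.
Definition valid x :=
  [/\ forall u, u \in cps x -> lvalid u, ci x <= cc x & cc x <= size (cps x)].

Lemma lgame_game u : lvalid u -> is_game (lgame u).
Proof. by case=> un pu; apply: subgame_is_game => //; exact: gG. Qed.

Lemma owin_END u l : lvalid u -> owin u = Some l -> is_END (lgame u) l.
Proof.
move=> vu; have [un pu] := vu; rewrite /owin un; case: asboolP => // -[_ lu] [<-].
split; last by rewrite /= cats0.
apply/atomic_leaf; first exact: lgame_game.
by split; rewrite /= ?cats0 // => -[m pm]; apply: lu; exists m; rewrite -cats1.
Qed.

Lemma owin_nonatomic u : lvalid u -> owin u = None -> nonleaf (loc Gamma u.1) u.2 /\ ~ atomic (lgame u).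
Proof.
move=> vu; have [un pu] := vu; rewrite /owin un; case: asboolP => // lu _.
have [m pm] : exists m, pos (loc Gamma u.1) (rcons u.2 m).
  by apply: contrapT => nm; apply: lu.
by split; [split=> //; exists m | apply: (@nonatomic_pos _ _ m); rewrite /= cats1].
Qed.

Lemma owinE u l : lvalid u -> (owin u == Some l) <-> is_END (lgame u) l.
Proof.
move=> vu; split=> [/eqP|[au wu]]; first exact: owin_END.
case E: (owin u) => [l'|]; first by have [_ wu'] := owin_END vu E; rewrite -wu -wu'.
by have [_] := owin_nonatomic vu E.
Qed.

(** Justifies that [leaf_step] searches for a dual label without asking whether the parameter lies
    in [I]. *)
Lemma END_label u a : lvalid u -> is_END (lgame u) (inr a) -> I a.
Proof.
move=> vu [au wu]; have [un pu] := vu; rewrite /= cats0 in wu; apply: (lG un) wu.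
have [_ nl] : leaf (lgame u) [::] by apply/atomic_leaf => //; exact: lgame_game.
by split=> // -[m pm]; apply: nl; exists m; rewrite /= cats1.
Qed.

(** If the indices up to [size J] all carried tried moves, these distinct moves would all occur in
    [J], which is too short for them. *)
Lemma find_first_untried (G : game A) J i : is_game G ->
  let k := find (fun k => if children G [::] k is Some m then ~~ tried J i m else true)
    (iota 0 (size J).+1) in
  forall m, first_untried G J i m <-> children G [::] k = Some m.
Proof.
move=> gG'; set P := fun k => _; set k := find _ _ => /= m.
have [_ /(_ [::])[_ inj E3] _ _] := gG'.
have hP : has P (iota 0 (size J).+1).
  apply: contrapT => /negP nP.
  have H l : l < (size J).+1 -> exists2 m, children G [::] l = Some m & tried J i m.
    move=> lJ; have := hasPn nP l; rewrite mem_iota => /(_ lJ); rewrite /P.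
    by case: children => [m0|] //; rewrite negbK; exists m0.
  pose g l := odflt (Drop 0) (children G [::] l).
  have /uniq_leq_size : uniq (map g (iota 0 (size J).+1)).
    rewrite map_inj_in_uniq ?iota_uniq // => l l'; rewrite !mem_iota /g => /H[m1 E1 _] /H[m2 E2 _].
    by rewrite E1 E2 /= => m12; apply: (inj l l' m1) => //; rewrite E2 m12.
  move=> /(_ (map (fun t : triple => t.1.2) J)); rewrite !size_map size_iota ltnn.
  case/(_ _)/notF => y /mapP[l]; rewrite mem_iota => /H[m1 E1 tr] ->.
  by case/hasP: tr => t tJ /andP[_ /eqP tm]; apply/mapP; exists t; rewrite // /g E1.
have kJ : k < (size J).+1 by move: hP; rewrite has_find size_iota.
have Pk : P k by have := nth_find 0 hP; rewrite nth_iota.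
have Pl l : l < k -> ~~ P l.
  move=> lk; have := before_find 0 lk; rewrite nth_iota ?add0n => [->//|]; lia.
split=> [[l [El nl tl]]|Ek]; last first.
  exists k; split=> //; first by move: Pk; rewrite /P Ek.
  by move=> l m' /Pl; rewrite /P => + E; rewrite E negbK.
case: (ltngtP l k) => [/Pl|kl|<-//]; first by rewrite /P El nl.
case E: (children G [::] k) => [m'|]; last by rewrite (E3 k l (ltnW kl) E) in El.
by move: Pk; rewrite /P E (tl _ _ kl E).
Qed.

Lemma exh_passes L i c J s : i < c -> passes I L i c J ->
  exh I L i c J s <-> exh I L i.+1 c J s.
Proof.
move=> ic pi; have [nE nP at_] := pi; split; last first.
  have [ai|ni] := pselect (atomic (loc L i)); first exact: exh_skip.
  by apply: exh_try_none => //; case: at_.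
move=> /exh_inv[[]|[[]|[[_ [j Ej]]|[[_ []]|[[_ []]|[_ [ni [m mi]]]]]]]] //; try lia.
- by case: nE; exists j.
- by case: at_ => // -[]; exists m.
Qed.

Lemma oneP s m : one s m <-> s = [::] \/ s = [:: m].
Proof. by rewrite /one; split=> [/orP[]/eqP|[]->]; rewrite ?eqxx ?orbT; auto. Qed.

(* Decreases in each step of the computation, as long as N bounds the number of
   local positions which the play can still produce. *)
Definition measure N x := size (cs x) * (N + N + 4) + (cc x - ci x) +
  (if cc x < size (cps x) then (size (cps x)).+1 else 0).

Definition step_spec N x (r : result) :=
  match r with
  | (Some b, _) => b <-> accepted x
  | (None, y) => [/\ valid y, size (cps y) + size (cs y) <= N, measure N y < measure N x
                   & accepted x <-> accepted y]
  end.

Lemma next_ok N x : valid x -> size (cps x) + size (cs x) <= N -> ci x < cc x ->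
  passes I (clocs x) (ci x) (cc x) (cJ x) -> step_spec N x (next x).
Proof.
case: x => [[ps [i c]] [J s]] [/= vps ic cL] sN; rewrite /cc /ci /= in ic cL * => lt pi; split=> //.
- by rewrite /measure /cc /ci /cps /cs /=; lia.
- exact: exh_passes.
Qed.

Lemma loc_clocs x j : j < size (cps x) -> loc (clocs x) j = lgame (nth (0, [::]) (cps x) j).
Proof. by move=> js; rewrite /loc /clocs (nth_map (0, [::])). Qed.

Lemma lvalid_nth x j : valid x -> j < size (cps x) -> lvalid (nth (0, [::]) (cps x) j).
Proof. by move=> [v _ _] js; apply: v; exact: mem_nth. Qed.

Lemma size_clocs x : size (clocs x) = size (cps x). Proof. exact: size_map. Qed.

Lemma leaf_step_ok N x l : valid x -> size (cps x) + size (cs x) <= N -> ci x < cc x ->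
  is_END (loc (clocs x) (ci x)) l -> step_spec N x (leaf_step x l).
Proof.
move=> vx sN lt El; have [_ _ cL] := vx.
have iL : ci x < size (cps x) by lia.
case: l El => [[] /= El|a /= El].
- split=> [/oneP|/exh_inv]; first exact: exh_stop.
  case=> [[]|[[]|[[_ [j [a [_ [_ E] _ _ _]] _]]|[[_ [_ H]]|[[_ [[_ nP _] _]]|[_ [ni _]]]]]]]; try lia.
  + by move: E; rewrite El.2.
  + exact/oneP.
  + by case: nP.
  + by case: ni; case: El.
- apply: next_ok => //; split; last by left; case: El.
  + by case=> j [a [_ [_ E]]]; move: E; rewrite El.2.
  + by case=> _; rewrite El.2.
have Ia : I a.
  by apply: (END_label (lvalid_nth vx iL)); rewrite -loc_clocs.
have Pj j : j < cc x -> (owin (nth (0, [::]) (cps x) j) == Some (inr (dual a))) <->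
    is_END (loc (clocs x) j) (inr (dual a)).
  by move=> jc; rewrite loc_clocs; [apply: owinE; apply: lvalid_nth => //; lia | lia].
set j0 := emidx x a.
have j0c : j0 <= cc x by rewrite /j0 /emidx -[leqRHS](size_iota 0) find_size.
have Hj0 : j0 < cc x -> em_clause I (clocs x) (ci x) (cc x) j0.
  move=> lt0; exists a; split=> //.
    apply/Pj => //; move: (lt0); rewrite /j0 /emidx -{2}(size_iota 0 (cc x)) -has_find => h.
    by have := nth_find 0 h; rewrite nth_iota ?add0n // -/(emidx x a) -/j0.
  move=> j' lt'; apply/Pj; first lia.
  have := before_find 0 lt'; rewrite nth_iota ?add0n => [->//|]; lia.
(* Leastness makes the partner in EM unique, so the index found is the one of every EM clause. *)
have uniq_em j : em_clause I (clocs x) (ci x) (cc x) j -> j0 = j.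
  case=> a' [_ [_]]; rewrite El.2 => -[<-] jc Ej nj.
  have hj : has (fun j => owin (nth (0, [::]) (cps x) j) == Some (inr (dual a))) (iota 0 (cc x)).
    by apply/hasP; exists j; rewrite ?mem_iota //; apply/Pj.
  have lt0 : j0 < cc x by move: hj; rewrite has_find size_iota.
  have [a'' [_ [_]]] := Hj0 lt0; rewrite El.2 => -[<-] _ E0 n0.
  by case: (ltngtP j0 j) => // [/nj|/n0].
case: ifP => lt0.
  split=> [/oneP|/exh_inv]; first by apply: exh_em => //; exact: Hj0.
  case=> [[]|[[]|[[_ [j Ej H]]|[[_ [[_ E] H]]|[[_ [[nE _ _] _]]|[_ [ni _]]]]]]]; try lia.
  + by apply/oneP; rewrite (uniq_em _ Ej).
  + by move: E; rewrite El.2.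
  + by case: nE; exists j0; exact: Hj0.
  + by case: ni; case: El.
apply: next_ok => //; split; last by left; case: El.
- case=> j Ej; have E := uniq_em _ Ej; have [a' [_ _ jc _ _]] := Ej.
  by rewrite -E lt0 in jc.
- by case=> _; rewrite El.2.
Qed.

Lemma try_step_ok N x (b : pred gmove) : valid x -> size (cps x) + size (cs x) <= N ->
  ci x < cc x -> ~ atomic (loc (clocs x) (ci x)) ->
  (forall m, try_move (clocs x) (cJ x) (ci x) m <-> b m) -> (exists m, b m) ->
  step_spec N x (try_step x (b (cm x))).
Proof.
move=> vx sN lt ni Hb [m0 bm0]; have [vps _ cL] := vx.
have iL : ci x < size (cps x) by lia.
have inv : accepted x -> exists2 m, try_move (clocs x) (cJ x) (ci x) m &
    (cs x = [::] \/ cs x = [:: Just (ci x) (size (cps x))] \/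
     exists2 s', cs x = [:: Just (ci x) (size (cps x)), m & s']
      & exh I (extend (clocs x) (ci x) m) (ci x).+1 (cc x)
          (rcons (cJ x) (ci x, m, size (cps x))) s').
  move=> /exh_inv; rewrite !size_clocs.
  case=> [[]|[[]|[[_ [j [a [_ E _ _ _]] _]]|[[_ [E _]]|[[_ [[_ _ H] _]]|[_ [_ H]]]]]]] //; try lia.
  - by case: ni; case: E.
  - by case: ni; case: E.
  - by case: H => // -[]; exists m0; apply/Hb.
rewrite /try_step; case: ifP => [/oneP H1|nH1].
  by split=> // _; apply: exh_try_just (proj2 (Hb m0) bm0) _; rewrite // size_clocs.
have E1 : accepted x -> exists2 s', [/\ cs x = [:: Just (ci x) (size (cps x)), cm x & s'] & b (cm x)]
      & exh I (extend (clocs x) (ci x) (cm x)) (ci x).+1 (cc x)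
          (rcons (cJ x) (ci x, cm x, size (cps x))) s'.
  case/inv=> m tm [E|[E|[s' E H]]].
  - by move/negP: nH1; case; apply/oneP; left.
  - by move/negP: nH1; case; apply/oneP; right.
  have Em : cm x = m by rewrite /cm E.
  by exists s'; rewrite Em //; split=> //; apply/Hb.
case: ifP => [/and3P[/eqP h0 sz bm]|nb]; last first.
  by split=> // /E1[s' [E bm] _]; move: nb; rewrite E bm /= eqxx.
have Es : cs x = [:: Just (ci x) (size (cps x)), cm x & drop 2 (cs x)].
  by rewrite -h0 /cm; case: (cs x) sz => [|? [|? ?]] //= _; rewrite drop0.
have vu : lvalid ((cu x).1, rcons (cu x).2 (cm x)).
  have vi := lvalid_nth vx iL; split; first by case: vi.
  have := try_move_pos _ (proj2 (Hb _) bm); rewrite loc_clocs //= -cats1; apply.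
  exact: lgame_game.
have EL : map lgame (rcons (cps x) ((cu x).1, rcons (cu x).2 (cm x))) =
    extend (clocs x) (ci x) (cm x).
  by rewrite map_rcons /extend loc_clocs // /lgame subgame_cat cats1.
have sc : size (cs x) = (size (drop 2 (cs x))).+2 by rewrite {1}Es.
pose y : conf := ((rcons (cps x) ((cu x).1, rcons (cu x).2 (cm x)), ((ci x).+1, cc x)),
            (rcons (cJ x) (ci x, cm x, size (cps x)), drop 2 (cs x))).
have Ey : accepted y = exh I (extend (clocs x) (ci x) (cm x)) (ci x).+1 (cc x)
    (rcons (cJ x) (ci x, cm x, size (cps x))) (drop 2 (cs x)).
  by rewrite /accepted /clocs -EL.
have sy : size (cps y) = (size (cps x)).+1 by rewrite size_rcons.
rewrite -/y; split.
- split; rewrite ?sy //; last exact: leqW.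
  by move=> u; rewrite mem_rcons inE => /orP[/eqP ->|]; [exact: vu | exact: vps].
- by rewrite sy -[cs y]/(drop 2 (cs x)); lia.
(* The two consumed moves release [2 * (N + N + 4)], more than the last summand can grow. *)
- rewrite /measure sy -[cs y]/(drop 2 (cs x)) -[cc y]/(cc x) -[ci y]/(ci x).+1 ltnS cL.
  rewrite sc in sN *; rewrite !mulSn.
  by move: (size (drop _ _) * _) => z; case: ifP; lia.
- rewrite Ey; split=> [/E1[s' [E _] H]|H]; first by rewrite E /= drop0.
  by rewrite /accepted Es -size_clocs; apply: exh_try_move; rewrite ?size_clocs //; exact/Hb.
Qed.

Lemma nonleaf_step_ok N x : valid x -> size (cps x) + size (cs x) <= N -> ci x < cc x ->
  owin (cu x) = None -> step_spec N x (nonleaf_step x).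
Proof.
move=> vx sN lt wN; have [_ _ cL] := vx.
have iL : ci x < size (cps x) by lia.
have vu := lvalid_nth vx iL; rewrite -/(cu x) in vu; have gu := lgame_game vu.
have Eu : loc (clocs x) (ci x) = lgame (cu x) by exact: loc_clocs.
have [nl na] := owin_nonatomic vu wN; have [un pu] := vu.
have tE : oturn (cu x) = Some (turn (loc (clocs x) (ci x)) [::]).
  by rewrite /oturn un asboolT // Eu /= cats0.
rewrite /nonleaf_step tE.
case: eqP => [[tP]|tO].
  have EF := find_first_untried (cJ x) (ci x) gu.
  have Ec k : children (lgame (cu x)) [::] k = ochild (cu x) k by rewrite /ochild un /= cats0.
  have EF' m : first_untried (lgame (cu x)) (cJ x) (ci x) m <-> ochild (cu x) (untried x) = Some m.
    rewrite EF Ec (@eq_find _ _ (fun k => if ochild (cu x) k is Some m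
      then ~~ tried (cJ x) (ci x) m else true)) // => k.
    by rewrite -Ec.
  case E: (ochild (cu x) (untried x)) => [m|].
    apply: (@try_step_ok N x (fun m' => m' == m)) => //; rewrite ?Eu //; last by exists m; rewrite eqxx.
    move=> m'; rewrite /try_move tP Eu EF' E.
    by split=> [[->]|/eqP ->].
  apply: next_ok => //; apply: nonatomic_passes; rewrite ?Eu // => -[m].
  by rewrite /try_move tP Eu EF' E.
have {}tO : turn (loc (clocs x) (ci x)) [::] = PlayerO by move: tO; case: turn.
case: ifP => h.
  apply: next_ok => //; apply: nonatomic_passes; rewrite ?Eu // => -[m].
  by rewrite /try_move tO h => -[].
have Ep m : opos ((cu x).1, rcons (cu x).2 m) <-> pos (loc (clocs x) (ci x)) [:: m].
  by rewrite /opos /= un Eu /= cats1; split=> /asboolP.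
apply: (@try_step_ok N x (fun m => opos ((cu x).1, rcons (cu x).2 m))) => //; rewrite ?Eu //.
  by move=> m; rewrite Ep /try_move tO h; split=> [[]|].
by have [m pm] := nonatomic_child gu na; exists m; apply/Ep; rewrite Eu.
Qed.

Lemma step_ok N x : valid x -> size (cps x) + size (cs x) <= N -> step_spec N x (step x).
Proof.
move=> vx sN; have [vps ic cL] := vx; rewrite /step.
case: eqP => [E|/eqP ne].
  case: ifP => lt; last first.
    have Ec : cc x = size (clocs x) by rewrite size_clocs; lia.
    rewrite -size_clocs; split=> [/oneP|].
      by rewrite /accepted E Ec; exact: exh_drop.
    by move=> /exh_inv[[_ [h _]]|[[_ [_ H]]|[[h _]|[[h _]|[[h _]|[h _]]]]]]; try lia; exact/oneP.
  split.
  - by split; rewrite /cps /ci /cc /=.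
  - by [].
  (* Before REPEAT the last summand is [(size (cps x)).+1], which pays for the new pass of length
     [size (cps x)]. *)
  - by rewrite /measure /= {1}/cs {1}/cc {1}/ci {1 2}/cc /= ltnn lt E; rewrite /cps /cs /=; lia.
  - have sz := size_clocs x; rewrite /accepted E; split.
      by move=> /exh_inv[[_ [_]]|[[_ [h _]]|[[h _]|[[h _]|[[h _]|[h _]]]]]]; rewrite ?sz //; lia.
    by move=> H; apply: exh_repeat; rewrite sz.
have lt : ci x < cc x by lia.
have iL : ci x < size (cps x) by lia.
case E: (owin (cu x)) => [l|]; last exact: nonleaf_step_ok.
by apply: leaf_step_ok => //; rewrite loc_clocs //; apply: owin_END E; exact: lvalid_nth.
Qed.

Lemma iter_run_step N k x : valid x -> size (cps x) + size (cs x) <= N -> measure N x < k ->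
  (iter k run_step (None, x)).1 == Some true <-> accepted x.
Proof.
elim: k x => // k IH x vx sN; rewrite ltnS => mk; rewrite iterSr {2}/run_step /=.
have := step_ok vx sN; case: (step x) => -[b|] y /=.
  move=> <-; have -> : iter k run_step (Some b, y) = (Some b, y) by elim: k {IH mk} => //= k ->.
  by case: b.
by case=> vy sy my ->; apply: IH => //; exact: leq_trans mk.
Qed.

Lemma simulate_EXH s : simulate s <-> EXH I Gamma s.
Proof.
set x := (init s).2; have sz : size (cps x) = n by rewrite size_map size_iota.
have EL : clocs x = Gamma.
  apply: (@eq_from_nth _ (END (inl PlayerP))); rewrite size_clocs sz // => i iN.
  rewrite -[LHS]/(loc _ _) loc_clocs ?sz // (nth_map 0) ?size_iota // nth_iota //.
  exact: subgame_nil.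
have -> : EXH I Gamma s <-> accepted x by rewrite /accepted EL.
apply: (@iter_run_step (n + size s)).
- split; rewrite ?sz //= => u /mapP[i]; rewrite mem_iota => iN ->.
  by split=> //; apply: pos_nil; exact: gG.
- by rewrite sz.
- by rewrite /measure sz /fuel /cc /ci /cs /= ltnn; lia.
Qed.

Lemma prim_rec_EXH : prim_rec_strategy Gamma (EXH I Gamma).
Proof.
apply: prim_rec_coded; have := pr_simulate.
have -> : simulate = (fun p => `[< EXH I Gamma p >]) => //.
by apply: funext => s; apply/idP/asboolP => /simulate_EXH.
Qed.

End Simulation.

Theorem mainTheorem4 (A : params) (Gamma : seq (game A)) (I : set A)
    (Gamma_games : forall i, i < size Gamma -> is_game (loc Gamma i))
    (I_selfdual : selfdual I)
    (FV_empty : FV (quant I Gamma) = set0) :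
  determined (quant I Gamma) /\
  ((forall eta, assignment I eta ->
      forall i, i < size Gamma -> determined (assign I eta (loc Gamma i))) ->
   ((exists S, g_winning (quant I Gamma) PlayerP S) <->
    (prim_rec_strategy Gamma (EXH I Gamma) /\
     g_winning (quant I Gamma) PlayerP (EXH I Gamma))) /\
   ((prim_rec_strategy Gamma (EXH I Gamma) /\
     g_winning (quant I Gamma) PlayerP (EXH I Gamma)) <->
    (forall eta, assignment I eta ->
       exists2 i, i < size Gamma &
         exists S, g_winning (assign I eta (loc Gamma i)) PlayerP S))).
Proof.
have [labels FVI] := FV_quant_empty I_selfdual Gamma_games FV_empty.
have qG := quant_is_game I Gamma_games.
have lost_O eta : assignment I eta -> (forall i, i < size Gamma ->
    exists S, g_winning (assign I eta (loc Gamma i)) PlayerO S) ->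
    exists S, g_winning (quant I Gamma) PlayerO S.
  move=> aeta H.
  have [S HS] : exists S : nat -> set (seq gmove), forall i, i < size Gamma ->
      g_winning (assign I eta (loc Gamma i)) PlayerO (S i).
    have HX i : exists S, i < size Gamma -> g_winning (assign I eta (loc Gamma i)) PlayerO S.
      by have [/H[S HS]|] := boolP (i < size Gamma); [exists S | exists set0].
    by have [S HS] := choice HX; exists S.
  (* [combine] reads only the trees of these games; the other fields are dummies. *)
  pose Ss := mkseq (fun i => Game (S i) (fun _ _ => None) (fun=> PlayerP)
    (fun=> inl PlayerP : label A) (fun=> set0)) (size Gamma).
  eexists; apply: (@combine_winning _ I eta I_selfdual aeta Gamma Ss) => //.
    by rewrite size_mkseq.
  by move=> i iG; rewrite [loc Ss i]/loc nth_mkseq //; exact: HS.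
have dich := EXH_winning_or_lost Gamma_games labels.
have prE := prim_rec_EXH Gamma_games labels.
split.
  case: dich => [W|[eta aeta /(lost_O _ aeta)[S W]]]; first by exists PlayerP, (EXH I Gamma).
  by exists PlayerO, S.
move=> det; split; split.
- case=> S WS; split=> //; case: dich => // -[eta aeta /(lost_O _ aeta)[S' WS']].
  by case: (no_two_winners qG WS WS').
- by case=> _ W; exists (EXH I Gamma).
- case=> _ W eta aeta; apply: contrapT => nP.
  (* Determinacy turns the lack of P-winning strategies for all [eta(G_i)] into O-winning ones,
     which are then combined. *)
  have [S' WS'] : exists S', g_winning (quant I Gamma) PlayerO S'.
    apply: (lost_O eta aeta) => i iG; have [[] [S WS]] := det eta aeta i iG; last by exists S.
    by case: nP; exists i => //; exists S.
  exact: no_two_winners qG W WS'.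
- move=> H; split=> //; case: dich => // -[eta aeta HO].
  have [i iG [S WS]] := H eta aeta; have [S' WS'] := HO i iG.
  by case: (no_two_winners (assign_is_game I eta (Gamma_games i iG)) WS WS').
Qed.
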